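(* Let $q=p^m$ be a prime power, let $n$ be a positive integer and let $1\le k\le\lfloor\frac{n}{q+1}\rfloor$. Assume that one of the following conditions holds: 1) $(n-1)\mid(q^2-1)$; 2) $n=tq$ with $1\le t\le q-1$; 3) $n=(t+1)N+1$, where $N\mid(q^2-1)$, $n_2=\frac{N}{\gcd(N,q+1)}$ and $1\le t\le\frac{q-1}{n_2}-2$. Then, for any $0\le\ell\le k-1$, there exist an $[[n,k-\ell,\ge n-k;\,n-k-\ell]]_q$ EAQECC and an $[[n,n-k-\ell,\ge k;\,k-\ell]]_q$ EAQECC.
   Context: An $[[n,k,d;c]]_q$ entanglement-assisted quantum error-correcting code (EAQECC) is a $q$-ary quantum code with $n$ transmitted qudits encoding $k$ qudits with the help of $c$ maximally entangled pairs pre-shared between sender and receiver, the receiver's halves being error-free. Explicitly (standard definition): for some unitary $W$ on $(\mathbb{C}^q)^{\otimes n}$, it is the $q^k$-dimensional subspace $Q=\{(W\otimes I)(|\phi\rangle\otimes|0\rangle^{\otimes(n-k-c)}\otimes|\Phi\rangle^{\otimes c}):|\phi\rangle\in(\mathbb{C}^q)^{\otimes k}\}$ of $(\mathbb{C}^q)^{\otimes n}\otimes(\mathbb{C}^q)^{\otimes c}$, where $|\Phi\rangle=q^{-1/2}\sum_{a\in\mathbb{F}_q}|a\rangle|a\rangle$, $W$ acts on the $n$ sender qudits (including the sender halves of the $c$ pairs), and $I$ acts on the $c$ receiver halves. It detects $d-1$ errors: for any $|\phi_1\rangle,|\phi_2\rangle\in Q$ with $\langle\phi_1|\phi_2\rangle=0$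 and any error operator $E=\zeta_p^sX(\mathbf a)Z(\mathbf b)$ ($\mathbf a,\mathbf b\in\mathbb{F}_q^n$, $s\in\mathbb{F}_p$) of quantum weight at most $d-1$, one has $\langle\phi_1|(E\otimes I)|\phi_2\rangle=0$. Here $p$ is the characteristic of $\mathbb{F}_q$, $\zeta_p$ is a complex primitive $p$-th root of unity, $X(\mathbf a)|\mathbf v\rangle=|\mathbf v+\mathbf a\rangle$, $Z(\mathbf b)|\mathbf v\rangle=\zeta_p^{\mathrm{tr}(\sum_i v_ib_i)}|\mathbf v\rangle$, $\mathrm{tr}:\mathbb{F}_q\to\mathbb{F}_p$ is the trace, and the quantum weight of $E$ is the number of $i$ with $(a_i,b_i)\ne(0,0)$. ''$\ge d_0$'' in place of $d$ means that the code has parameter $d$ for some $d\ge d_0$. The letters $n,k,\ell,t,N$ denote integers, $N\geq1$. *)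

(* Defs.v *)
From mathcomp Require Import all_boot all_order all_algebra all_field.
From mathcomp Require Export reals complex.

Set Implicit Arguments.
Unset Strict Implicit.
Unset Printing Implicit Defensive.

Import GRing.Theory Num.Theory.
Local Open Scope ring_scope.

Section Trace.
Variables (p m : nat) (F : finFieldType).

(* The trace of F_q / F_p for q = p ^ m, first as an element of F, then as the
   element of 'F_p it comes from (see trFpE). *)
Definition frob_trace (x : F) : F := \sum_(i < m) x ^+ (p ^ i).

Definition trFp (x : F) : 'F_p :=
  odflt 0 [pick z : 'F_p | (z%:R : F) == frob_trace x].

Lemma trFpE (x : F) : prime p -> #|F| = (p ^ m)%N ->
  (trFp x)%:R = frob_trace x.
Proof.
move=> p_pr cardF; rewrite /trFp; case: pickP => [z /eqP //|/= noz].
have pcharFp : p \in [pchar F] by apply: card_finPcharP cardF p_pr.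
pose L : splittingFieldType 'F_p := pPrimeCharType pcharFp.
suff : (frob_trace x : L) \in (1%AS : {subfield L}).
  case/vlineP=> a xE; have /eqP[] := noz a.
  by rewrite /= [in RHS]xE; apply: esym; apply: (mulr1 (a%:R : F)).
rewrite Fermat's_little_theorem dimv1 expn1 card_Fp //.
have pcharLp : p \in [pchar L] := pcharFp.
rewrite -(pFrobenius_autE pcharLp) [X in _ _ X == _]/(frob_trace x).
rewrite /frob_trace rmorph_sum /=.
under eq_bigr do rewrite pFrobenius_autE -exprM -expnSr.
case: (posnP m) => [m0|m_gt0].
  by move: m0; case: (m) => // _; rewrite !big_ord0.
rewrite -(prednK m_gt0) big_ord_recr big_ord_recl /= addrC.
rewrite prednK // -cardF; apply/eqP; congr (_ + _).
by rewrite expn0 expr1 expf_card.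
Qed.

End Trace.

Section Operators.
Variable C : numClosedFieldType.

(* A vector of the Hilbert space with orthonormal basis T is the function of
   its coordinates; operators are matrices indexed by the enumeration of T. *)
Definition inner (T : finType) (f g : {ffun T -> C}) : C :=
  \sum_x (f x)^* * g x.

Definition opmx (T : finType) (A : T -> T -> C) : 'M[C]_#|T| :=
  \matrix_(i, j) A (enum_val i) (enum_val j).

(* (A (x) I) psi on the tensor product of the spaces with bases S and T. *)
Definition act_left (S T : finType) (A : 'M[C]_#|S|)
    (psi : {ffun S * T -> C}) : {ffun S * T -> C} :=
  [ffun st => \sum_s A (enum_rank st.1) (enum_rank s) * psi (s, st.2)].

End Operators.

Section EAQECC.
Variables (C : numClosedFieldType) (p m : nat) (F : finFieldType) (zeta : C).

Section Errors.
Variable n : nat.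

(* X(a)|v> = |v + a>  and  Z(b)|v> = zeta ^ tr(v . b) |v>. *)
Definition Xop (a : 'rV[F]_n) : 'M[C]_#|{: 'rV[F]_n}| :=
  opmx (fun u v : 'rV[F]_n => (u == v + a)%:R).

Definition Zop (b : 'rV[F]_n) : 'M[C]_#|{: 'rV[F]_n}| :=
  opmx (fun u v : 'rV[F]_n =>
    zeta ^+ trFp p m (\sum_i v 0 i * b 0 i) * (u == v)%:R).

Definition error_op (s : 'F_p) (a b : 'rV[F]_n) : 'M[C]_#|{: 'rV[F]_n}| :=
  zeta ^+ s *: (Xop a *m Zop b).

Definition qweight (a b : 'rV[F]_n) : nat :=
  #|[set i | (a 0 i, b 0 i) != (0, 0)]|.

End Errors.

(* |Phi> = q^(-1/2) sum_a |a>|a>. *)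
Definition ebit : {ffun F * F -> C} :=
  [ffun xy => (sqrtC #|F|%:R)^-1 * (xy.1 == xy.2)%:R].

(* |phi> (x) |0>^r (x) |Phi>^c, where the sender's word of length k + r + c
   ends with the sender halves of the c pairs, and the second component of the
   basis label holds the receiver halves. *)
Definition eaq_input (k r c : nat) (phi : {ffun 'rV[F]_k -> C}) :
    {ffun 'rV[F]_(k + r + c) * 'rV[F]_c -> C} :=
  [ffun vw : 'rV[F]_(k + r + c) * 'rV[F]_c =>
     phi (lsubmx (lsubmx vw.1))
     * (\prod_(i < r) (rsubmx (lsubmx vw.1) 0 i == 0)%:R)
     * (\prod_(j < c) ebit (rsubmx vw.1 0 j, vw.2 0 j))].

Definition eaq_code (k r c : nat) (W : 'M[C]_#|{: 'rV[F]_(k + r + c)}|)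
    (psi : {ffun 'rV[F]_(k + r + c) * 'rV[F]_c -> C}) : Prop :=
  exists phi, psi = act_left W (eaq_input r c phi).

(* Weight at most d - 1 is written as weight < d. *)
Definition detects (n c d : nat)
    (Q : {ffun 'rV[F]_n * 'rV[F]_c -> C} -> Prop) : Prop :=
  forall phi1 phi2, Q phi1 -> Q phi2 -> inner phi1 phi2 = 0 ->
  forall (s : 'F_p) (a b : 'rV[F]_n), (qweight a b < d)%N ->
  inner phi1 (act_left (error_op s a b) phi2) = 0.

(* An [[n, k, d; c]]_q code exists. The number r of ancillas |0> is n - k - c;
   writing n = k + r + c also enforces k + c <= n. *)
Definition EAQECC (n k d c : nat) : Prop :=
  exists (r : nat) (W : 'M[C]_#|{: 'rV[F]_(k + r + c)}|),
    [/\ n = (k + r + c)%N, W \is unitarymx & detects d (eaq_code W)].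

Definition EAQECC_ge (n k d0 c : nat) : Prop :=
  exists2 d, (d0 <= d)%N & EAQECC n k d c.

End EAQECC.

(* Main.v *)
From HB Require Import structures.
Require Import Defs.
From mathcomp Require Import all_boot all_order all_algebra all_field.
From mathcomp Require Import reals complex.
From mathcomp Require Import ring zify.

(* In each of the three cases there are n points of F_{q^2} that are the roots
   of a polynomial f dividing X^{q^2} - X whose derivative takes values in F_q
   at these roots. By Lagrange interpolation the sum of g(a) / f'(a) over the
   roots a vanishes for deg g < n - 1, so that the weights 1 / f'(a), which are
   norms from F_{q^2}, make the generalized Reed-Solomon code of dimension k
   Hermitian self-orthogonal. Multiplying k - l of the weights by some c <> 1
   in F_q turns the Gram matrix into one of rank k - l, so that the Hermitian
   hull has dimension l. For q = 2 one is forced to take c = 0, but then k = 1,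
   and the minimum distance drops only to n - k.

   If H is a generator matrix of a code over F_{q^2} with Gram matrix of rank
   c, diagonalizing the Gram matrix gives c more columns M such that the rows of
   (H | M) span a Hermitian self-orthogonal code. The associated stabilizer code
   on n + c qudits detects every nontrivial error on the last c qudits, hence
   its reduced state there is maximally mixed, and the code has the form
   (W (x) I)(|phi> |0> |Phi>^c). It detects the errors on the first n qudits
   that are not Hermitian orthogonal to H. The theorem uses for H the perturbed
   Reed-Solomon code and its Hermitian dual. *)

Set Implicit Arguments.
Unset Strict Implicit.
Unset Printing Implicit Defensive.
Import Order.TTheory GRing.Theory Num.Theory.
Local Open Scope ring_scope.
Local Open Scope sesquilinear_scope.

(** * Quadratic extensions of finite fields *)

(** Since x^2 + x vanishes at both 0 and -1, it is not injective on [F], so it misses a value c;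
    then X^2 + X - c has no root and is irreducible. *)
Lemma quadratic_extension (F : finFieldType) :
  exists (L : finFieldType) (iota : {rmorphism F -> L}),
  exists2 bar : {rmorphism L -> L},
  forall x, bar x = x ^+ #|F| & #|L| = (#|F| ^ 2)%N.
Proof.
pose f (x : F) := x ^+ 2 + x.
have [c Hc] : exists c, forall x, f x != c.
  case: (pickP [pred c | [forall x, f x != c]]) => [c /forallP Hc|no]; first by exists c.
  have surj y : y \in codom f.
    move: (no y) => /= /negbT; rewrite negb_forall => /existsP[x].
    by rewrite negbK => /eqP <-; apply: codom_f.
  have /image_injP inj : #|image f F| == #|F|.
    by rewrite eqn_leq leq_image_card /= -[X in (X <= _)%N]cardsT
         subset_leq_card //; apply/subsetP => y _; apply: surj.
  have := inj 0 (-1) isT isT; rewrite /f expr0n /= add0r sqrrN expr1n subrr.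
  by move=> /(_ erefl)/esym/eqP; rewrite oppr_eq0 oner_eq0.
pose p : {poly F} := 'X^2 + 'X - c%:P.
have sp : size p = 3.
  rewrite /p -addrA size_polyDl size_polyXn //.
  by rewrite (leq_ltn_trans (size_polyD _ _)) // size_polyX size_polyN
    size_polyC gtn_max; case: eqP.
have irr : irreducible_poly p.
  apply: cubic_irreducible; rewrite ?sp // => x.
  by rewrite rootE !hornerE subr_eq0 -/(f x).
have [K dimK _] := irredp_FAdjoin irr.
have [p0 _ pcharF] := finPcharP F.
pose L := FinFieldExtType K; pose iota := in_alg K : {rmorphism F -> L}.
have qnat : [pchar L].-nat #|F|.
  have pcharL : p0 \in [pchar L] by rewrite (fmorph_pchar iota).
  rewrite (eq_pnat _ (pcharf_eq pcharL)) (card_pprimeChar pcharF) pnatX.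
  by rewrite pnat_id // (pcharf_prime pcharF).
exists L, iota.
pose frob := fun x : L => x ^+ #|F|.
have fA : zmod_morphism frob by move=> x y; rewrite /frob exprDn_pchar // exprNn_pchar.
have fM : monoid_morphism frob by split=> [|x y]; rewrite /frob ?expr1n ?exprMn.
pose bar : {rmorphism L -> L} := HB.pack frob
  (GRing.isZmodMorphism.Build _ _ frob fA) (GRing.isMonoidMorphism.Build _ _ frob fM).
exists bar; first by [].
have := @card_vspacef F (finvect_type K) (Vector.class (finvect_type K)).
rewrite card_vspace => <-; congr (_ ^ _)%N.
by rewrite [LHS]dimK sp.
Qed.

(** X^|K| - X is the product of X - x over all x in [K], so its monic divisors are the products over
    subsets. *)
Lemma dvdp_finField_split (K : finFieldType) (f : {poly K}) :
    f \is monic -> f %| 'X^#|K| - 'X ->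
  f = \prod_(x in root f) ('X - x%:P).
Proof.
move=> f_monic; rewrite finField_genPoly -big_enum /=.
move=> /dvdp_prod_XsubC[mk eqf].
set s := mask _ _ in eqf; have us : uniq s by rewrite mask_uniq // enum_uniq.
have {}eqf : f = \prod_(x <- s) ('X - x%:P).
  apply/eqP; rewrite -eqp_monic // monic_prod_XsubC //.
rewrite [LHS]eqf -big_enum /=; apply: perm_big; apply: uniq_perm => //.
  exact: enum_uniq.
by move=> x; rewrite mem_enum; transitivity (root f x); rewrite // eqf root_prod_XsubC.
Qed.

Section QuadraticExtension.
Variables (F L : finFieldType) (iota : {rmorphism F -> L}).
Variable bar : {rmorphism L -> L}.
Hypothesis barE : forall x, bar x = x ^+ #|F|.
Hypothesis cardL : #|L| = (#|F| ^ 2)%N.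

Lemma barK : involutive bar.
Proof. by move=> x; rewrite !barE -exprM mulnn -cardL expf_card. Qed.

Lemma bar_iota y : bar (iota y) = iota y.
Proof. by rewrite barE -rmorphXn /= expf_card. Qed.

(** X^q - X already splits over [F], so it has no further root in [L]. *)
Lemma bar_fixed x : bar x = x -> exists y, iota y = x.
Proof.
rewrite barE => xq.
have : root (map_poly iota ('X^#|F| - 'X)) x.
  by rewrite rmorphB /= map_polyXn map_polyX rootE !hornerE xq subrr.
have -> : map_poly iota ('X^#|F| - 'X) = \prod_(z <- codom iota) ('X - z%:P).
  rewrite finField_genPoly rmorph_prod big_image /=.
  by apply: eq_bigr => y _; rewrite rmorphB /= map_polyX map_polyC.
by rewrite root_prod_XsubC => /mapP[y _ ->]; exists y.
Qed.

Lemma bar_moves : exists g, bar g != g.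
Proof.
case: (pickP [pred g | bar g != g]) => [g|fixL]; first by exists g.
have : (#|L| <= #|F|)%N.
  rewrite -(card_codom (fmorph_inj iota)); apply: subset_leq_card.
  apply/subsetP => x _; have /negbFE/eqP/bar_fixed[y <-] := fixL x.
  exact: codom_f.
rewrite cardL -{2}(expn1 #|F|) leq_exp2l //; exact: finNzRing_gt1.
Qed.

(** The trace form is nondegenerate: 1 has nonzero trace in odd characteristic, any element moved by
    [bar] in characteristic 2. *)
Lemma trace_nonzero s : s != 0 -> exists x, x * s + bar (x * s) != 0.
Proof.
move=> s0.
suff [x x0] : exists x, x + bar x != 0 by exists (x / s); rewrite divfK.
have [g gg] := bar_moves; have [c2|c2] := eqVneq (2%:R : L) 0.
  exists g; rewrite addr_eq0 eq_sym; apply: contraNneq gg => gE.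
  by rewrite -subr_eq0 -{2}gE opprK -mulr2n -mulr_natl c2 mul0r.
by exists 1; rewrite rmorph1.
Qed.

(** With Z = X^(q+1), X^(q^2) - X equals X (Z^(q-1) - 1), which Z - y divides for nonzero y in [F];
    so X^(q+1) - y has a root in [L]. *)
Lemma norm_surjective y : exists x, x * bar x = iota y.
Proof.
have [->|y0] := eqVneq y 0; first by exists 0; rewrite mul0r rmorph0.
have q1 : (1 < #|F|)%N := finNzRing_gt1 F.
have splits : 'X^(#|F|.+1) - (iota y)%:P %| 'X^#|L| - 'X.
  have -> : 'X^#|L| - 'X = 'X * (('X^(#|F|.-1) - 1) \Po 'X^(#|F|.+1)) :> {poly L}.
    rewrite comp_polyB comp_Xn_poly comp_polyC -exprM mulrBr mulr1 -exprS.
    by congr ('X^_ - _); rewrite cardL; nia.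
  rewrite dvdp_mull //.
  have -> : 'X^(#|F|.+1) - (iota y)%:P = ('X - (iota y)%:P) \Po 'X^(#|F|.+1).
    by rewrite comp_polyB comp_polyX comp_polyC.
  rewrite dvdp_comp_poly // dvdp_XsubCl rootE !hornerE.
  have yq : y ^+ #|F|.-1 = 1.
    by apply: (mulfI y0); rewrite -exprS prednK ?mulr1 ?expf_card // ltnW.
  by rewrite -rmorphXn /= yq rmorph1 subrr.
have fE := dvdp_finField_split (monicXnsubC _ (ltn0Sn _)) splits.
have [x] : exists x, root ('X^(#|F|.+1) - (iota y)%:P) x.
  case: (pickP (root ('X^(#|F|.+1) - (iota y)%:P))) => [x|no]; first by exists x.
  move: fE; rewrite big_pred0 // => /(congr1 (fun r : {poly L} => size r)).
  by rewrite size_XnsubC // size_poly1.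
rewrite rootE !hornerE subr_eq0 => /eqP xq.
by exists x; rewrite barE -exprS.
Qed.

Lemma iota_coords_inj g a b : bar g != g ->
  iota a + g * iota b = 0 -> a = 0 /\ b = 0.
Proof.
move=> gg; have [->|b0] := eqVneq b 0.
  by rewrite rmorph0 mulr0 addr0 => /eqP; rewrite fmorph_eq0 => /eqP.
move=> /eqP; rewrite addrC addr_eq0 => /eqP ga; case/negP: gg.
have ib0 : iota b != 0 by rewrite fmorph_eq0.
rewrite -(mulfK ib0 g) ga -rmorphN -fmorphV -rmorphM /=.
by rewrite bar_iota.
Qed.

Lemma iota_coords g : bar g != g -> exists re im : L -> F,
  [/\ forall x, x = iota (re x) + g * iota (im x),
      {morph re : x y / x + y} & {morph im : x y / x + y}].
Proof.
move=> gg; pose f (u : F * F) := iota u.1 + g * iota u.2.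
have f_inj : injective f.
  move=> [a b] [c d] /= /eqP; rewrite -subr_eq0 /f /= opprD addrACA -mulrBr -!rmorphB.
  by move/eqP/(iota_coords_inj gg) => [/eqP + /eqP]; rewrite !subr_eq0 => /eqP-> /eqP->.
have [h hK Kh] : bijective f.
  by apply: inj_card_bij => //; rewrite card_prod cardL -mulnn.
have hD x y : h (x + y) = h x + h y.
  apply: f_inj; rewrite Kh /f /= -{1}(Kh x) -{1}(Kh y) /f !rmorphD mulrDr.
  by rewrite addrACA.
exists (fun x => (h x).1), (fun x => (h x).2); split=> [x|x y|x y].
- by rewrite -[LHS]Kh.
- by rewrite hD.
- by rewrite hD.
Qed.

End QuadraticExtension.

(** * Evaluation points *)

(** Interpolating g at S by the polynomials f / (X - x) gives g itself. These are monic of degree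
    |S| - 1, so the sum is the coefficient of g in that degree, which is 0. *)
Lemma lagrange_sum (K : fieldType) (S : seq K) (f g : {poly K}) :
    uniq S -> f = \prod_(x <- S) ('X - x%:P) -> (size g < size S)%N ->
  \sum_(x <- S) g.[x] / f^`().[x] = 0.
Proof.
move=> uS fE ltg; pose r x := f %/ ('X - x%:P).
have rootf x : (x \in S) = root f x by rewrite fE root_prod_XsubC.
have fr x : x \in S -> f = r x * ('X - x%:P).
  by rewrite rootf -dvdp_XsubCl => /divpK.
have derf x : x \in S -> f^`().[x] = (r x).[x].
  move=> xS; rewrite {1}(fr x xS) derivM derivXsubC mulr1.
  by rewrite !hornerE subrr mulr0 add0r.
have derf0 x : x \in S -> f^`().[x] != 0.
  move=> xS; rewrite derf //; have: separable_poly f.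
    by rewrite fE separable_prod_XsubC.
  by rewrite (fr x xS) separable_root => /andP[_].
have rxy x y : x \in S -> y \in S -> y != x -> (r x).[y] = 0.
  move=> xS yS yx; have := yS; rewrite rootf (fr x xS) rootM root_XsubC.
  by rewrite (negPf yx) orbF => /eqP.
have size_f : size f = (size S).+1 by rewrite fE size_prod_XsubC.
have f_monic : f \is monic by rewrite fE monic_prod_XsubC.
have size_r x : size (r x) = size S.
  by rewrite /r size_divp ?polyXsubC_eq0 // size_XsubC size_f subn1.
have lead_r x : x \in S -> (r x)`_(size S).-1 = 1.
  move=> xS; rewrite -(size_r x) -lead_coefE; apply/monicP.
  by move: f_monic; rewrite (fr x xS) monicMr ?monicXsubC.
pose h := \sum_(x <- S) (g.[x] / f^`().[x]) *: r x.
have hE : h = g.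
  apply/eqP; rewrite -subr_eq0; apply: contraTT isT => hg0 /=.
  have allr : all (root (h - g)) S.
    apply/allP => y yS; rewrite rootE hornerD hornerN subr_eq0 horner_sum.
    rewrite (bigD1_seq y) //= big_seq_cond big1 => [|x /andP[xS yx]].
      by rewrite addr0 hornerZ -derf // divfK ?derf0.
    by rewrite hornerZ rxy ?mulr0 // eq_sym.
  have := max_poly_roots hg0 allr uS; rewrite ltnNge => /negP; case.
  rewrite (leq_trans (size_polyD _ _)) // geq_max size_polyN (ltnW ltg) andbT.
  apply: (leq_trans (size_sum _ _ _)); apply/bigmax_leqP_seq => x _ _.
  by rewrite (leq_trans (size_scale_leq _ _)) // size_r.
have := congr1 (fun p : {poly K} => p`_(size S).-1) hE.
rewrite /h coef_sum [RHS]nth_default; last by rewrite -ltnS prednK // (leq_ltn_trans _ ltg).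
move=> h_lead; rewrite -[RHS]h_lead !big_seq.
by apply: eq_bigr => x xS; rewrite coefZ lead_r ?mulr1.
Qed.

(** With d the gcd, N / d divides (q - 1) ((q + 1) / d) and is coprime to the second factor. *)
Lemma dvdn_cofactor_gcd N q : (0 < N)%N -> (N %| q ^ 2 - 1)%N ->
  (N %/ gcdn N (q + 1) %| q - 1)%N.
Proof.
move=> N0 Ndvd; set d := gcdn N (q + 1).
have d0 : (0 < d)%N by rewrite gcdn_gt0 N0.
have NE : N = (N %/ d * d)%N by rewrite divnK ?dvdn_gcdl.
have cop : coprime (N %/ d) ((q + 1) %/ d).
  by rewrite /coprime -(eqn_pmul2r d0) muln_gcdl mul1n -NE divnK ?dvdn_gcdr.
rewrite -(Gauss_dvdr _ cop) -(dvdn_pmul2r d0) -NE mulnAC divnK ?dvdn_gcdr //.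
by apply: dvdn_trans Ndvd _; rewrite mulnC -subn_sqr.
Qed.

Section Points.
Variables (F L : finFieldType) (iota : {rmorphism F -> L}).
Hypothesis cardL : #|L| = (#|F| ^ 2)%N.
Local Notation q := #|F|.

(* Multipliers w i in F_q that turn the evaluations at the a i of the
   polynomials of degree < k into a Hermitian self-orthogonal code, as soon as
   (k - 1) (q + 1) < n - 1. *)
Definition good_points n (a : 'I_n -> L) (w : 'I_n -> F) :=
  [/\ injective a, forall i, w i != 0 &
      forall e, (e < n.-1)%N -> \sum_i iota (w i) * a i ^+ e = 0].

Lemma good_points_roots n (f : {poly L}) :
    f \is monic -> f %| 'X^#|L| - 'X -> size f = n.+1 ->
    (forall x, root f x -> exists y, iota y = f^`().[x]) ->
  exists (a : 'I_n -> L) (w : 'I_n -> F), good_points a w.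
Proof.
move=> f_monic fdvd sf fder.
have := dvdp_finField_split f_monic fdvd; rewrite -big_enum /=.
set S := enum _ => fE; have uS : uniq S by apply: enum_uniq.
have sS : size S = n by move: sf; rewrite fE size_prod_XsubC => -[].
pose a (i : 'I_n) := nth 0 S i.
have rootf x : (x \in S) = root f x by rewrite fE root_prod_XsubC.
have aS i : a i \in S by rewrite mem_nth // sS.
have derf0 x : x \in S -> f^`().[x] != 0.
  move=> xS; have : separable_poly f by rewrite fE separable_prod_XsubC.
  have := xS; rewrite rootf -dvdp_XsubCl => /divpK <-.
  rewrite separable_root => /andP[_].
  by rewrite derivM derivXsubC mulr1 !hornerE subrr mulr0 add0r.
have [v vE] : exists v : 'I_n -> F, forall i, iota (v i) = f^`().[a i].
  apply: (@fin_all_exists _ (fun=> F) (fun i y => iota y = f^`().[a i])) => i.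
  by apply: fder; rewrite -rootf.
exists a, (fun i => (v i)^-1); split=> [i j /eqP|i|e lte].
- by rewrite /a nth_uniq ?sS ?ltn_ord // => /eqP/val_inj.
- by rewrite invr_eq0 -(fmorph_eq0 iota) vE derf0.
have := @lagrange_sum _ S f 'X^e uS fE.
rewrite size_polyXn sS (big_nth 0) sS big_mkord => E; rewrite -[RHS]E; last by case: (n) lte.
 apply: eq_bigr => i _.
by rewrite hornerXn mulrC fmorphV vE.
Qed.

(** The points are the x whose trace x^q + x lies in a set of t elements of [F], q points for each:
    f = g(X^q + X). As q = 0 in [L], f' = g'(X^q + X), which has values in [F] at the roots. *)
Lemma good_points_trace t : (0 < t <= q)%N ->
  exists (a : 'I_(t * q) -> L) (w : 'I_(t * q) -> F), good_points a w.
Proof.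
case/andP=> t0 tq; pose B := take t (enum F).
have uB : uniq B by rewrite take_uniq ?enum_uniq.
have sB : size B = t by rewrite size_takel // -cardE.
pose g := \prod_(b <- B) ('X - b%:P).
have q1 : (1 < q)%N := finNzRing_gt1 F.
have sh : size ('X^q + 'X : {poly L}) = q.+1.
  by rewrite size_polyDl ?size_polyXn // size_polyX.
have h_monic : 'X^q + 'X \is @monic L.
  by rewrite monicE lead_coefDl ?lead_coefXn // size_polyXn size_polyX.
have sg : size (map_poly iota g) = t.+1 by rewrite size_map_poly size_prod_XsubC sB.
have g_monic : map_poly iota g \is monic by rewrite monic_map ?monic_prod_XsubC.
pose f := map_poly iota g \Po ('X^q + 'X).
have q0L : q%:R = 0 :> L.
  have [p _ pcharF] := finPcharP F.
  have pcharL : p \in [pchar L] by rewrite (fmorph_pchar iota).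
  apply/eqP; rewrite -(dvdn_pcharf pcharL).
  have := card_pprimeChar pcharF; case: logn => [qE|k ->].
    by rewrite qE in q1.
  by rewrite dvdn_exp.
have f_monic : f \is monic.
  rewrite monicE lead_coef_comp ?sh ?ltnS 1?ltnW //.
  by rewrite (monicP g_monic) (monicP h_monic) expr1n mulr1.
apply: (@good_points_roots _ f) => //.
(* X^(q^2) - X is (X^q + X)^q - (X^q + X), and g divides Z^q - Z. *)
- have dvE : map_poly iota ('X^q - 'X) \Po ('X^q + 'X) = 'X^#|L| - 'X.
    rewrite rmorphB /= map_polyXn map_polyX comp_polyB comp_Xn_poly comp_polyX.
    have [p _ pcharF] := finPcharP F.
    have pcharL : p \in [pchar {poly L}] by rewrite pchar_poly (fmorph_pchar iota).
    rewrite exprDn_pchar; last first.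
      rewrite (eq_pnat _ (pcharf_eq pcharL)) (card_pprimeChar pcharF) pnatX.
      by rewrite pnat_id // (pcharf_prime pcharF).
    by rewrite -exprM mulnn -cardL opprD addrA addrK.
  rewrite -dvE; apply: dvdp_comp_poly; rewrite dvdp_map.
  apply: uniq_roots_dvdp; last by rewrite uniq_rootsE.
  by apply/allP => x _; rewrite rootE !hornerE expf_card subrr.
- have := size_comp_poly (map_poly iota g) ('X^q + 'X); rewrite -/f sg sh /=.
  by move=> <-; rewrite prednK // size_poly_gt0 monic_neq0.
move=> x; rewrite rootE horner_comp => /eqP gx0.
have {gx0} : root (map_poly iota g) ('X^q + 'X).[x] by apply/eqP.
have -> : map_poly iota g = \prod_(z <- map iota B) ('X - z%:P).
  rewrite rmorph_prod big_map; apply: eq_bigr => b _.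
  by rewrite rmorphB /= map_polyX map_polyC.
rewrite root_prod_XsubC => /mapP[b _ xE].
exists g^`().[b]; rewrite deriv_comp hornerM horner_comp xE.
rewrite deriv_map horner_map /= derivD derivXn derivX.
by rewrite hornerD hornerMn -[X in _ * (X + _)]mulr_natr q0L mulr0 add0r hornerE mulr1.
Qed.

(** The points are 0 and s cosets of the N-th roots of unity: f = X g(X^N), where g has s roots
    among the M-th roots of unity of [F], M = (q - 1) / n2. At a root x, x^N lies in [F], hence so
    does f'(x) = g(x^N) + N x^N g'(x^N). *)
Lemma good_points_cosets N s : (0 < N)%N -> (N %| q ^ 2 - 1)%N ->
    (0 < s <= (q - 1) %/ (N %/ gcdn N (q + 1)))%N ->
  exists (a : 'I_(s * N + 1) -> L) (w : 'I_(s * N + 1) -> F), good_points a w.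
Proof.
move=> N0 Ndvd /andP[s0 sM]; have q1 : (1 < q)%N := finNzRing_gt1 F.
set d := gcdn N (q + 1) in sM; set n2 := (N %/ d)%N in sM.
have d0 : (0 < d)%N by rewrite gcdn_gt0 N0.
have NE : N = (n2 * d)%N by rewrite divnK ?dvdn_gcdl.
have n2dvd : (n2 %| q - 1)%N by apply: dvdn_cofactor_gcd.
set M := ((q - 1) %/ n2)%N in sM; have ME : (q - 1 = M * n2)%N by rewrite divnK.
have M0 : (0 < M)%N by apply: leq_trans sM.
have dvdX (K : finFieldType) a b : (a * b)%N = #|K|.-1 -> (0 < a)%N ->
    'X * ('X^a - 1) %| ('X^#|K| - 'X : {poly K}).
  move=> abK a0; have -> : 'X^#|K| - 'X = 'X * ('X^(a * b) - 1) :> {poly K}.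
    by rewrite mulrBr mulr1 -exprS abK prednK // ltnW // finNzRing_gt1.
  rewrite dvdp_mul2l ?polyX_eq0 // exprM -(expr1n _ b) subrXX.
  by rewrite expr1n dvdp_mulr.
have rootsM : 'X^M - 1 %| ('X^q - 'X : {poly F}).
  apply: dvdp_trans (dvdX F M n2 _ M0); first by rewrite dvdp_mull.
  by rewrite -ME subn1.
have := dvdp_finField_split (monicXnsubC 1 M0) rootsM; rewrite -big_enum /=.
set U := enum _ => UE; pose B := take s U.
have sU : size U = M.
  by have := size_Xn_sub_1 F M0; rewrite UE size_prod_XsubC => -[].
have uB : uniq B by rewrite take_uniq ?enum_uniq.
have sB : size B = s by rewrite size_takel // sU.
pose g := \prod_(b <- B) ('X - b%:P).
have g_dvd : g %| 'X^M - 1.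
  by rewrite UE -(cat_take_drop s U) big_cat dvdp_mulr.
have sg : size (map_poly iota g) = s.+1 by rewrite size_map_poly size_prod_XsubC sB.
have g_monic : map_poly iota g \is monic by rewrite monic_map ?monic_prod_XsubC.
have sh : size ('X^N : {poly L}) = N.+1 by rewrite size_polyXn.
pose f := 'X * (map_poly iota g \Po 'X^N).
have c_monic : map_poly iota g \Po 'X^N \is monic.
  rewrite monicE lead_coef_comp ?sh //.
  by rewrite (monicP g_monic) lead_coefXn expr1n mulr1.
apply: (@good_points_roots _ f).
- by rewrite monicMr ?monicX.
- have NM : (N * M * ((q + 1) %/ d))%N = #|L|.-1.
    rewrite cardL -subn1 -[X in (_ - X)%N](exp1n 2) subn_sqr ME NE.
    by rewrite -[in RHS](divnK (dvdn_gcdr N (q + 1))) -/d; lia.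
  apply: dvdp_trans (dvdX L _ _ NM _); last by rewrite muln_gt0 N0.
  rewrite dvdp_mul2l ?polyX_eq0 //.
  have -> : 'X^(N * M) - 1 = map_poly iota ('X^M - 1) \Po 'X^N.
    by rewrite rmorphB rmorph1 /= map_polyXn comp_polyB comp_Xn_poly comp_polyC exprM.
  by apply: dvdp_comp_poly; rewrite dvdp_map.
- rewrite /f mulrC size_mulX ?monic_neq0 // addn1.
  have := size_comp_poly (map_poly iota g) 'X^N; rewrite sg sh /=.
  by move=> <-; rewrite prednK // size_poly_gt0 monic_neq0.
move=> x; rewrite rootE hornerM hornerX horner_comp hornerXn => gx0.
have [b xE] : exists b, x ^+ N = iota b.
  move: gx0; rewrite mulf_eq0 => /orP[/eqP->|gx0].
    by exists 0; rewrite expr0n gtn_eqF // rmorph0.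
  have {gx0} : root (map_poly iota g) (x ^+ N) by [].
  have -> : map_poly iota g = \prod_(z <- map iota B) ('X - z%:P).
    rewrite rmorph_prod big_map; apply: eq_bigr => b _.
    by rewrite rmorphB /= map_polyX map_polyC.
  by rewrite root_prod_XsubC => /mapP[b _ xE]; exists b.
exists (g.[b] + N%:R * b * g^`().[b]).
rewrite /f derivM derivX mul1r deriv_comp derivXn.
rewrite !(hornerD, hornerM, horner_comp, hornerX, hornerMn, hornerXn) xE.
rewrite deriv_map !horner_map /= rmorphD !rmorphM rmorph_nat /= -xE -mulr_natl.
by rewrite -{2}(prednK N0) exprS; ring.
Qed.

End Points.

(** * Hermitian codes *)

Definition weight (L : nzRingType) n (x : 'rV[L]_n) : nat := #|[set i | x 0 i != 0]|.

Definition dagger (L : nzRingType) (bar : L -> L) m n (A : 'M[L]_(m, n)) :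
  'M[L]_(n, m) := map_mx bar A^T.

(** Test [y] against the polynomial of degree less than k that vanishes on all of its support but
    one point: a single term survives. *)
Lemma small_support_eq0 (K : fieldType) s k (a y : 'I_s -> K) :
    injective a -> (forall j, (j < k)%N -> \sum_i y i * a i ^+ j = 0) ->
    (#|[set i | y i != 0%R]| <= k)%N ->
  forall i, y i = 0%R.
Proof.
move=> a_inj yP ltk i0; apply/eqP; apply: contraT => yi0.
pose f := \prod_(i in [set i | y i != 0%R] :\ i0) ('X - (a i)%:P).
have sf : (size f <= k)%N.
  rewrite /f -big_enum size_prod_XsubC -cardE /=.
  by rewrite (cardsD1 i0) inE yi0 in ltk.
have : \sum_i y i * f.[a i] = 0.
  under eq_bigr => i _ do rewrite (horner_coef_wide _ sf) mulr_sumr.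
  rewrite exchange_big big1 //= => j _.
  under eq_bigr => i _ do rewrite mulrCA.
  by rewrite -mulr_sumr yP // mulr0.
rewrite (bigD1 i0) //= big1 => [/eqP|i ii0].
  rewrite addr0 mulf_eq0 (negPf yi0) /= horner_prod => /prodf_eq0/=.
  case=> i; rewrite !inE => /andP[ii0 _].
  by rewrite hornerXsubC subr_eq0 => /eqP/a_inj ei; rewrite ei eqxx in ii0.
have [->|yi] := eqVneq (y i) 0; first by rewrite mul0r.
rewrite horner_prod (bigD1 i) ?inE ?ii0 //= hornerXsubC subrr mul0r mulr0 //.
Qed.

Section Hermitian.
Variables (F L : finFieldType) (iota : {rmorphism F -> L}).
Variable bar : {rmorphism L -> L}.
Hypothesis barE : forall x, bar x = x ^+ #|F|.
Hypothesis cardL : #|L| = (#|F| ^ 2)%N.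
Local Notation q := #|F|.
Local Notation "A ^h" := (dagger bar A) (at level 8, format "A ^h").
Local Notation barK := (barK barE cardL).

Lemma daggerK m n (A : 'M[L]_(m, n)) : A^h^h = A.
Proof. by apply/matrixP => i j; rewrite !mxE barK. Qed.

Lemma dagger_mul m n r (A : 'M[L]_(m, n)) (B : 'M[L]_(n, r)) :
  (A *m B)^h = B^h *m A^h.
Proof. by rewrite /dagger trmx_mul map_mxM. Qed.

Lemma daggerB m n (A B : 'M[L]_(m, n)) : (A - B)^h = A^h - B^h.
Proof. by rewrite /dagger linearB /= map_mxB. Qed.

Lemma dagger0 m n : (0 : 'M[L]_(m, n))^h = 0.
Proof. by rewrite /dagger trmx0 map_mx0. Qed.

Lemma rank_dagger m n (A : 'M[L]_(m, n)) : \rank A^h = \rank A.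
Proof. by rewrite /dagger mxrank_map mxrank_tr. Qed.

(** Polarization: if the form vanished on the diagonal, every multiple of each of its values would
    have trace 0, against [trace_nonzero]. *)
Lemma hermitian_form_nonzero m (A : 'M[L]_m) : A^h = A -> A != 0 ->
  exists v : 'rV[L]_m, (v *m A *m v^h) 0 0 != 0.
Proof.
move=> hA; case: (pickP [pred v : 'rV[L]_m | (v *m A *m v^h) 0 0 != 0]) => [v|no].
  by exists v.
case/negP; apply/eqP/matrixP => i j; rewrite [RHS]mxE.
pose h (u v : 'rV[L]_m) := (u *m A *m v^h) 0 0.
have h0 v : h v v = 0 by have /negbFE/eqP := no v.
have hbar u v : h v u = bar (h u v).
  by rewrite /h -[in LHS]hA -[v in LHS]daggerK -!dagger_mul mulmxA !mxE.
have hD u v : h u v + h v u = 0.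
  have := h0 (u + v).
  have -> : h (u + v) (u + v) = h u u + h u v + (h v u + h v v).
    rewrite /h; have -> : (u + v)^h = u^h + v^h by rewrite /dagger linearD /= map_mxD.
    by rewrite !mulmxDl !mulmxDr !mxE.
  by rewrite !h0 add0r addr0.
have hZ x u v : h (x *: u) v = x * h u v by rewrite /h -!scalemxAl mxE.
have -> : A i j = h (delta_mx 0 i) (delta_mx 0 j).
  rewrite /h -rowE; have -> : (delta_mx 0 j : 'rV[L]_m)^h = delta_mx j 0.
    by rewrite /dagger trmx_delta map_delta_mx.
  by rewrite -colE !mxE.
apply/eqP; apply: contraT => s0.
have [x] := trace_nonzero iota barE cardL s0.
by rewrite -hZ -hbar hD eqxx.
Qed.

(** Gram-Schmidt: a vector v with v A v^h = 1 splits off the rank one term u u^h, where u = A v^h,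
    and this lowers the rank. *)
Lemma hermitian_factor c m (A : 'M[L]_m) : A^h = A -> (\rank A <= c)%N ->
  exists M : 'M[L]_(m, c), A = M *m M^h.
Proof.
elim: c A => [|c IHc] A hA rA.
  exists 0; rewrite mul0mx; apply/eqP; by rewrite -mxrank_eq0 -leqn0.
have [A0|A0] := eqVneq A 0; first by exists 0; rewrite mul0mx.
have [v0 v0A] := hermitian_form_nonzero hA A0.
have v0h : (v0 *m A *m v0^h)^h = v0 *m A *m v0^h.
  by rewrite !dagger_mul daggerK hA mulmxA.
have [y yE] : exists y, iota y = (v0 *m A *m v0^h) 0 0.
  by apply: (bar_fixed iota barE); rewrite -[in RHS]v0h !mxE.
(* Scaling [v0] by x multiplies its form value y by the norm of x, which is chosen to be 1 / y. *)
have [x xE] := norm_surjective iota barE cardL y^-1.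
pose v := x *: v0; pose u := A *m v^h.
have vu : v *m u = 1%:M.
  have vhE : v^h = bar x *: v0^h by rewrite /dagger linearZ /= map_mxZ.
  rewrite [LHS]mx11_scalar /u vhE /v -scalemxAr -scalemxAr -scalemxAl scalerA mxE.
  by rewrite mulmxA -yE [bar x * x]mulrC xE fmorphV mulVf // yE.
have uh : u^h = v *m A by rewrite /u dagger_mul daggerK hA.
have A'lt : (A - u *m u^h < A)%MS.
  rewrite /ltmx; apply/andP; split.
    have -> : A - u *m u^h = (1%:M - u *m v) *m A.
      by rewrite mulmxBl mul1mx uh mulmxA.
    exact: submxMl.
  (* The inclusion is strict: v^h is killed by A - u u^h but not by A. *)
  apply/negP => /submxP[D AE].
  have : v *m u = 0.
    rewrite /u AE -[D *m _ *m _]mulmxA mulmxBl -/u -[u *m _ *m _]mulmxA uh.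
    by rewrite -[v *m A *m _]mulmxA -/u vu mulmx1 subrr !mulmx0.
  by rewrite vu => /matrixP/(_ 0 0)/eqP; rewrite !mxE oner_eq0.
have [M' M'E] : exists M' : 'M[L]_(m, c), A - u *m u^h = M' *m M'^h.
  apply: IHc; first by rewrite daggerB dagger_mul daggerK hA.
  by rewrite -ltnS (leq_trans _ rA) // rank_ltmx.
rewrite -add1n; exists (row_mx u M').
transitivity (u *m u^h + M' *m M'^h); first by rewrite -M'E addrC subrK.
by rewrite -mul_row_col /dagger tr_row_mx map_col_mx.
Qed.

(** [G] has the entries v i * a i ^ j, where v i has the perturbed weight [w' i] as its norm. In the
    Gram matrix the exponents j + q j' are less than n - 1, so subtracting the vanishing sums with
    the weights [w] leaves only the first k - l columns. *)
Lemma grs_code n k l (a : 'I_n -> L) (w : 'I_n -> F) :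
    good_points iota a w -> (0 < k)%N -> (k * (q + 1) <= n)%N -> (l < k)%N ->
    (q = 2 -> k = 1)%N ->
  exists G : 'M[L]_(k, n),
    [/\ forall y : 'rV[L]_k, y != 0 -> (n - k <= weight (y *m G))%N,
        forall x : 'rV[L]_n, x *m G^h = 0 -> x != 0 -> (k <= weight x)%N &
        \rank (G *m G^h) = (k - l)%N].
Proof.
case=> a_inj w0 wP k0 kn lk q2.
have q1 : (1 < q)%N := finNzRing_gt1 F.
(* Having c != 1 changes the weights, and c != 0 keeps them nonzero. Only for q = 2 must c be 0;
   then k = 1. *)
have [c c1 c0] : exists2 c : F, c != 1 & (c = 0 -> k = 1%N).
  have [/q2 k1|qn2] := eqVneq q 2; first by exists 0; rewrite // eq_sym oner_eq0.
  have : [set~ (0 : F)] :\ 1 != set0.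
    rewrite -card_gt0; have := cardsD1 1 [set~ (0 : F)].
    rewrite cardsC1 !inE oner_eq0 /= => qE; rewrite -(ltn_add2l 1) -qE.
    by move: q1 qn2; case: #|F| => [|[|[|?]]].
  case/set0Pn => c; rewrite !inE => /andP[c1 c0]; exists c => // c0'.
  by rewrite c0' eqxx in c0.
pose w' (i : 'I_n) := if (i < k - l)%N then c * w i else w i.
have [v vE] : exists v : 'I_n -> L, forall i, v i * bar (v i) = iota (w' i).
  apply: (@fin_all_exists _ (fun=> L) (fun i x => x * bar x = iota (w' i))) => i.
  exact: norm_surjective.
have v0 i : v i = 0 -> c = 0 /\ (i < k - l)%N.
  move=> vi0; have := vE i; rewrite vi0 mul0r /w' => /esym/eqP; rewrite fmorph_eq0.
  by case: ifP => _; rewrite ?mulf_eq0 (negPf (w0 i)) ?orbF // => /eqP.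
pose G : 'M[L]_(k, n) := \matrix_(j, i) (v i * a i ^+ j).
exists G; split.
- move=> y y0; pose f := rVpoly y.
  have f0 : f != 0 by rewrite -(inj_eq (can_inj rVpolyK)) linear0 in y0 *.
  have GE i : (y *m G) 0 i = v i * f.[a i].
    rewrite mxE (horner_coef_wide _ (size_poly _ _)) mulr_sumr.
    by apply: eq_bigr => j _; rewrite mxE coef_rVpoly_ord mulrCA.
  pose S := [set i | (y *m G) 0 i != 0].
  have := cardsC S; rewrite card_ord -[#|S|]/(weight (y *m G)) => nE.
  (* The zeros of y G come from the at most k - 1 roots of f and from the i with v i = 0. The latter
     occur only for c = 0, where k = 1 leaves no root and at most one such i. *)
  have : (#|~: S| <= k)%N.
    apply: (@leq_trans #|[set i | v i == 0%R] :|: [set i | root f (a i)]|).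
      apply/subset_leq_card/subsetP => i.
      by rewrite !inE negbK GE mulf_eq0.
    rewrite (leq_trans (leq_card_setU _ _)) //.
    have r1 : (#|[set i | root f (a i)]| <= k.-1)%N.
      rewrite cardE -(size_map a) -ltnS prednK //.
      apply: leq_trans (max_poly_roots f0 _ _) (size_poly _ _).
        by apply/allP => _ /mapP[i + ->]; rewrite mem_enum inE.
      by rewrite map_inj_uniq ?enum_uniq.
    case: (eqVneq c 0) => [/c0 k1|cn0].
      rewrite k1 /= in r1 *; rewrite (leq_trans _ (_ : (1 + 0 <= 1)%N)) // leq_add //.
      apply: (@leq_trans #|[set i : 'I_n | (i == 0 :> nat)]|).
        apply/subset_leq_card/subsetP => i; rewrite !inE => /eqP/v0[_].
        by rewrite k1; lia.
      rewrite leqNgt; apply/negP => /card_gt1P[i [j [/[!inE] /eqP i0 /eqP j0]]].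
      by case/eqP; apply: val_inj; rewrite /= i0 j0.
    rewrite (_ : [set i | v i == 0] = set0) ?cards0 ?add0n; last first.
      by apply/setP => i; rewrite !inE; apply/negP => /eqP/v0[/eqP]; rewrite (negPf cn0).
    by rewrite (leq_trans r1) // leq_pred.
  by lia.
- move=> x xG; apply: contraNT; rewrite -ltnNge => wx; apply/eqP/rowP => i.
  (* For k = 1 the claim is trivial; otherwise no v i is 0. *)
  rewrite [RHS]mxE; case: (eqVneq k 1%N) => [k1|kn1].
    move: wx; rewrite k1 ltnS leqn0 cards_eq0 => /eqP/setP/(_ i).
    by rewrite !inE => /negbFE/eqP.
  have xv : x 0 i * bar (v i) = 0.
    apply: (@small_support_eq0 L n k (bar \o a) (fun i => x 0 i * bar (v i))).
    - exact: inj_comp (fmorph_inj _) a_inj.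
    - move=> j jk; have /rowP/(_ (Ordinal jk)) := xG; rewrite !mxE => E; rewrite -[RHS]E.
      by apply: eq_bigr => i' _; rewrite !mxE rmorphM rmorphXn mulrA.
    rewrite (leq_trans _ (ltnW wx)) //; apply/subset_leq_card/subsetP => i'.
    by rewrite !inE mulf_eq0 negb_or => /andP[].
  have vi : v i != 0 by apply/eqP => /v0[/c0 k1]; rewrite k1 in kn1.
  by move/eqP: xv; rewrite mulf_eq0 fmorph_eq0 (negPf vi) orbF => /eqP.
have kln : (k - l <= n)%N by nia.
pose V : 'M[L]_(k, k - l) := \matrix_(j, i) a (widen_ord kln i) ^+ j.
pose D : 'M[L]_(k - l) := diag_mx (\row_i iota ((c - 1) * w (widen_ord kln i))).
have -> : G *m G^h = V *m D *m V^h.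
  apply/matrixP => j j'; rewrite mul_mx_diag !mxE.
  pose e := (j + q * j')%N.
  have ee : (e < n.-1)%N by rewrite /e; have := ltn_ord j; have := ltn_ord j'; nia.
  rewrite -[LHS]subr0 -[X in _ - X](wP e ee) -sumrB.
  rewrite (eq_bigr (fun i : 'I_n => if (i < k - l)%N then
      iota ((c - 1) * w i) * a i ^+ e else 0)) => [|i _]; last first.
    rewrite !mxE rmorphM rmorphXn mulrACA vE /w' barE -exprM /e exprD.
    by case: ifP => _; rewrite ?subrr // mulrBl mul1r rmorphB mulrBl.
  rewrite -big_mkcond /= (big_ord_narrow kln) /=.
  by apply: eq_bigr => i _; rewrite !mxE rmorphXn barE -exprM /e exprD mulrCA mulrA.
have freeV : row_free V^T.
  apply: inj_row_free => y yV; apply/rowP => i; rewrite [RHS]mxE.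
  apply: (@small_support_eq0 L _ k (a \o widen_ord kln) (fun i => y 0 i)).
  - by apply: inj_comp => // i1 i2 /(congr1 val) /= /val_inj.
  - move=> j jk; have /rowP/(_ (Ordinal jk)) := yV; rewrite !mxE => E; rewrite -[RHS]E.
    by apply: eq_bigr => i' _; rewrite !mxE.
  by rewrite (leq_trans (max_card _)) // card_ord leq_subr.
have rV : \rank V = (k - l)%N by rewrite -mxrank_tr; apply/eqP.
have freeVh : row_free V^h by rewrite /row_free rank_dagger rV.
have unitD : D \in unitmx.
  rewrite unitmxE det_diag unitfE; apply/prodf_neq0 => i _.
  by rewrite mxE fmorph_eq0 mulf_neq0 ?subr_eq0.
by rewrite mxrankMfree // mxrankMfree ?row_free_unit.
Qed.

End Hermitian.

(** * Stabilizer codes from Weyl operators *)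

(** In a rank factorization P = L U, cancelling the outer factors in P P = P gives U L = 1, and tr P
    = tr (U L). *)
Lemma mxtrace_idempotent (K : fieldType) n (P : 'M[K]_n) :
  P *m P = P -> \tr P = (\rank P)%:R.
Proof.
move=> PP; rewrite -{1}[P]mulmx_base mxtrace_mulC.
suff -> : row_base P *m col_base P = 1%:M by rewrite mxtrace1.
have [c cE] := row_fullP (col_base_full P).
have [r rE] := row_freeP (row_base_free P).
have PP' : (col_base P *m row_base P) *m (col_base P *m row_base P) =
    col_base P *m row_base P by rewrite mulmx_base.
move: (col_base P) (row_base P) cE rE PP' => L U cE rE LUP.
have := congr1 (fun M => c *m M *m r) LUP.
by rewrite /= !mulmxA cE !mul1mx -!mulmxA rE mulmx1.
Qed.

Section Weyl.
Variables (C : numClosedFieldType) (T : finZmodType) (e : T -> T -> C).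
Hypothesis eD : forall x y z, e (x + y) z = e x z * e y z.
Hypothesis eC : forall x y, e x y = e y x.
Hypothesis e_nondeg : forall x, x != 0 -> exists z, e z x != 1.
Hypothesis e_norm : forall x y, `|e x y| = 1.

Lemma bichar0 x : e 0 x = 1.
Proof.
have e0 : e 0 x != 0 by rewrite -normr_eq0 e_norm oner_eq0.
by apply: (mulfI e0); rewrite -eD addr0 mulr1.
Qed.

Lemma bichar_sum x : \sum_z e z x = #|T|%:R * (x == 0)%:R.
Proof.
have [->|x0] := eqVneq x 0.
  under eq_bigr => z _ do rewrite eC bichar0.
  by rewrite sumr_const mulr1.
have [y y1] := e_nondeg x0; rewrite mulr0.
have : e y x * \sum_z e z x = \sum_z e z x.
  rewrite mulr_sumr [RHS](reindex_inj (addrI y)) /=.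
  by apply: eq_bigr => z _; rewrite eD.
move/eqP; rewrite -subr_eq0 -{2}[\sum_z _]mul1r -mulrBl mulf_eq0.
by rewrite subr_eq0 (negPf y1) => /eqP.
Qed.

Lemma sum_enum_val (R : nmodType) (f : T -> R) :
  \sum_(i < #|T|) f (enum_val i) = \sum_t f t.
Proof. by rewrite -big_enum_val. Qed.

Lemma opmx_mul (f g : T -> T -> C) :
  opmx f *m opmx g = opmx (fun w u => \sum_t f w t * g t u).
Proof.
apply/matrixP => i j; rewrite !mxE -sum_enum_val.
by apply: eq_bigr => k _; rewrite !mxE.
Qed.

(* The operator X(a) Z(b), acting on row vectors of coordinates. *)
Definition weyl (a b : T) : 'M[C]_#|T| :=
  opmx (fun w u => e w b * (u == w + a)%:R).

Lemma weyl_mul a b a' b' :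
  weyl a b *m weyl a' b' = e a b' *: weyl (a + a') (b + b').
Proof.
rewrite opmx_mul; apply/matrixP => i j; rewrite !mxE.
rewrite (bigD1 (enum_val i + a)) //= eqxx mulr1 big1 ?addr0 => [|t /negPf->].
  by rewrite eD addrA [e _ (b + b')]eC eD ![e _ (enum_val i)]eC; ring.
by rewrite mulr0 mul0r.
Qed.

Lemma weyl00 : weyl 0 0 = 1%:M.
Proof.
apply/matrixP => i j; rewrite !mxE eC bichar0 mul1r addr0 eq_sym.
by rewrite (inj_eq enum_val_inj).
Qed.

Lemma weyl_unitary a b : weyl a b \is unitarymx.
Proof.
apply/unitarymxP/matrixP => i j; rewrite !mxE.
under eq_bigr => k _ do rewrite !mxE.
rewrite (sum_enum_val (fun u => e (enum_val i) b * (u == enum_val i + a)%:R *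
  (e (enum_val j) b * (u == enum_val j + a)%:R)^*)).
rewrite (bigD1 (enum_val i + a)) //= eqxx mulr1 big1 ?addr0 => [|t /negPf->].
  rewrite (inj_eq (addIr a)) (inj_eq enum_val_inj) rmorphM rmorph_nat mulrA.
  have [->|ij] := eqVneq i j; last by rewrite mulr0.
  by rewrite -normCK e_norm expr1n mulr1.
by rewrite mulr0 mul0r.
Qed.

Lemma weyl_trace a b : \tr (weyl a b) = #|T|%:R * ((a == 0) && (b == 0))%:R.
Proof.
rewrite /mxtrace; under eq_bigr => i _ do rewrite mxE.
rewrite (sum_enum_val (fun u => e u b * (u == u + a)%:R)).
under eq_bigr => u _ do rewrite -{2}[u]addr0 (inj_eq (addrI u)) eq_sym.
by rewrite -mulr_suml bichar_sum -mulrA -natrM mulnb andbC.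
Qed.

(** The pairs (A y, B y) form an isotropic subgroup of T x T of order |Y|. Their Weyl operators
    commute, and [D] will be the dimension of a common eigenspace. *)
Variables (Y : finZmodType) (A B : Y -> T) (D : nat).
Hypothesis AD : {morph A : y z / y + z}.
Hypothesis BD : {morph B : y z / y + z}.
Hypothesis isotropic : forall y z, e (A y) (B z) = e (A z) (B y).
Hypothesis ABinj : forall y, A y = 0 -> B y = 0 -> y = 0.
Hypothesis cardT : #|T| = (#|Y| * D)%N.

Let W y := weyl (A y) (B y).

Let WM y z : W y *m W z = e (A y) (B z) *: W (y + z).
Proof. by rewrite /W weyl_mul AD BD. Qed.

Let A0 : A 0 = 0. Proof. by apply: (addrI (A 0)); rewrite -AD !addr0. Qed.
Let B0 : B 0 = 0. Proof. by apply: (addrI (B 0)); rewrite -BD !addr0. Qed.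

(* The eigenvalues of a common eigenvector supply the phases that make the
   commuting Weyl operators a group. *)
Lemma stabilizer_phases : exists th : Y -> C,
  [/\ th 0 = 1, forall y, `|th y| = 1 &
      forall y z, th y * th z * e (A y) (B z) = th (y + z)].
Proof.
have T0 : (0 < #|T|)%N by apply/card_gt0P; exists 0.
have [v v0 vW] : exists2 v : 'rV[C]_#|T|, v != 0 &
    all (fun M => stablemx v M) [seq W y | y : Y].
  apply: common_eigenvector => // _ _ /imageP[y _ ->] /imageP[z _ ->].
  by rewrite /comm_mx !WM addrC isotropic.
have {vW} [la laE] : exists la : Y -> C, forall y, v *m W y = la y *: v.
  apply: (@fin_all_exists _ (fun=> C) (fun y l => v *m W y = l *: v)) => y.
  by apply/sub_rVP; have /allP := vW; apply; apply: image_f.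
have scv (x x' : C) : x *: v = x' *: v -> x = x'.
  by move/eqP; rewrite -subr_eq0 -scalerBl scaler_eq0 (negPf v0) orbF subr_eq0 => /eqP.
have laM y z : la y * la z = e (A y) (B z) * la (y + z).
  apply: scv; rewrite -[RHS]scalerA -laE scalemxAr -WM mulmxA laE -scalemxAl laE.
  by rewrite scalerA.
have la0 : la 0 = 1 by apply: scv; rewrite -laE /W A0 B0 weyl00 mulmx1 scale1r.
have laN y : `|la y| = 1.
  have vv : (v *m v^t*) 0 0 != 0 by rewrite -dotmxE dnorm_eq0.
  have : (v *m W y) *m (v *m W y)^t* = v *m v^t*.
    rewrite trmx_mul map_mxM mulmxA -[v *m _ *m _]mulmxA.
    by rewrite (unitarymxP (weyl_unitary _ _)) mulmx1.
  rewrite laE linearZ /= map_mxZ -scalemxAr -scalemxAl scalerA => /matrixP/(_ 0 0).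
  rewrite mxE -normCKC => E; apply/eqP; rewrite -(@sqrp_eq1 C) //; apply/eqP.
  by apply: (mulIf vv); rewrite mul1r.
have lan0 y : la y != 0 by rewrite -normr_eq0 laN oner_eq0.
exists (fun y => (la y)^-1); split=> [|y|y z].
- by rewrite la0 invr1.
- by rewrite normfV laN invr1.
have := laM y z; have := lan0 y; have := lan0 z; have := lan0 (y + z).
move=> n1 n2 n3 E; have e0 : e (A y) (B z) != 0 by rewrite -normr_eq0 e_norm oner_eq0.
by rewrite -invfM E invfM mulrAC mulVf // mul1r.
Qed.

(** The average [P] of the operators with phases projects onto the code space. Only y = 0
    contributes to its trace, so its rank is |T| / |Y| = D. *)
Lemma stabilizer_code : exists psi : 'I_D -> T -> C,
  (forall i j, \sum_u (psi i u)^* * psi j u = (i == j)%:R) /\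
  (forall a b, (exists y, e (A y) b != e a (B y)) ->
    forall i j, \sum_u (psi i (u + a))^* * (e u b * psi j u) = 0).
Proof.
have [th [th0 thN thM]] := stabilizer_phases.
pose Q y := th y *: W y.
have QM y z : Q y *m Q z = Q (y + z).
  by rewrite /Q -scalemxAl -scalemxAr WM !scalerA thM.
have Qunit y : Q y \is unitarymx.
  apply/unitarymxP; rewrite /Q linearZ /= map_mxZ -scalemxAl -scalemxAr scalerA.
  by rewrite -normCK thN expr1n scale1r; apply/unitarymxP/weyl_unitary.
have Y0 : #|Y|%:R != 0 :> C by rewrite pnatr_eq0 -lt0n; apply/card_gt0P; exists 0.
pose P := #|Y|%:R^-1 *: \sum_y Q y.
have PQ y : P *m Q y = P.
  rewrite /P -scalemxAl mulmx_suml; congr (_ *: _).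
  rewrite [RHS](reindex_inj (addIr y)) /=.
  by apply: eq_bigr => z _; rewrite QM.
have PP : P *m P = P.
  rewrite {2}/P -scalemxAr mulmx_sumr (eq_bigr (fun=> P)) => [|y _]; last exact: PQ.
  by rewrite sumr_const -scaler_nat scalerA mulVf // scale1r.
have rP : \rank P = D.
  apply/eqP; rewrite -(eqr_nat C) -mxtrace_idempotent // /P linearZ /= raddf_sum /=.
  rewrite (bigD1 0) //= big1 => [|y y0]; last first.
    rewrite /Q linearZ /= weyl_trace; have [Ay|] := eqVneq (A y) 0; last by rewrite !mulr0.
    have [By|] := eqVneq (B y) 0; last by rewrite !mulr0.
    by rewrite (ABinj Ay By) eqxx in y0.
  rewrite /Q th0 scale1r weyl_trace A0 B0 !eqxx addr0 mulr1 cardT natrM.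
  by rewrite mulrA mulVf // mul1r.
pose S := schmidt (row_base P).
have Sunit : S \is unitarymx by apply: schmidt_unitarymx; apply: rank_leq_col.
have SP : (S <= P)%MS.
  by rewrite /S (eqmx_schmidt_free (row_base_free P)) eq_row_base.
have SQ y : S *m Q y = S by have /submxP[X ->] := SP; rewrite -mulmxA PQ.
pose psi (i : 'I_D) u := S (cast_ord (esym rP) i) (enum_rank u).
exists psi; split=> [i j|a b [y yab] i j].
  have /unitarymxP/matrixP/(_ (cast_ord (esym rP) j) (cast_ord (esym rP) i)) := Sunit.
  rewrite !mxE (inj_eq (@cast_ord_inj _ _ _)) eq_sym => <-.
  rewrite -sum_enum_val; apply: eq_bigr => k _.
  by rewrite /psi enum_valK !mxE mulrC.
pose E := weyl a b; pose G := S *m E *m S^t*.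
(* [E] commutes with [Q y] up to a phase other than 1, while [Q y] fixes the code; hence the
   compression [G] of [E] is a nontrivial multiple of itself. *)
have EQ : E *m Q y = (e a (B y) / e (A y) b) *: (Q y *m E).
  rewrite /Q /W -scalemxAr -scalemxAl !weyl_mul !scalerA [A y + a]addrC [B y + b]addrC.
  have e0 : e (A y) b != 0 by rewrite -normr_eq0 e_norm oner_eq0.
  by rewrite [_ * th y]mulrC -[th y * _ * _]mulrA divfK.
have GE : G = (e a (B y) / e (A y) b) *: G.
  rewrite /G -{3}(SQ y) scalemxAl -[S *m Q y *m E]mulmxA scalemxAr -EQ mulmxA.
  rewrite -[in LHS](mulmx1 (S *m E)) -(unitarymxP (Qunit y)).
  by rewrite mulmxA -[LHS]mulmxA -map_mxM -trmx_mul SQ.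
have G0 : G = 0.
  apply/eqP; move/eqP: GE; rewrite -subr_eq0 -{1}[G]scale1r -scalerBl scaler_eq0.
  case/orP=> //; rewrite subr_eq0 => /eqP w1; case/eqP: yab.
  have e0 : e (A y) b != 0 by rewrite -normr_eq0 e_norm oner_eq0.
  by apply: (mulIf (invr_neq0 e0)); rewrite mulfV.
have /matrixP/(_ (cast_ord (esym rP) j) (cast_ord (esym rP) i)) := G0.
rewrite !mxE => GE0; rewrite -[RHS]GE0.
rewrite (reindex_inj (addIr (- a))) /= -[LHS]sum_enum_val; apply: eq_bigr => k _.
rewrite !mxE (bigD1 (enum_rank (enum_val k - a))) //= big1 => [|t tk]; last first.
  rewrite mxE; case: eqVneq => [kE|]; last by rewrite !mulr0.
  by rewrite kE addrK enum_valK eqxx in tk.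
by rewrite mxE enum_rankK !subrK eqxx mulr1 addr0 /psi enum_valK mulrC [e _ _ * _]mulrC.
Qed.

End Weyl.

(** * Entanglement-assisted codes from orthonormal vectors *)

(** Rows are added one at a time: with the free rows replaced by 0 the matrix is singular, and a
    normalized kernel vector of its adjoint is orthogonal to the rows already fixed. *)
Lemma unitary_completion (C : numClosedFieldType) N (P : pred 'I_N) (M : 'M[C]_N) :
    (forall i j, P i -> P j -> (M *m M^t*) i j = (i == j)%:R) ->
  exists2 U : 'M[C]_N, U \is unitarymx & forall i j, P i -> U i j = M i j.
Proof.
have [k] := ubnP #|predC P|; elim: k P M => // k IHk P M; rewrite ltnS => ltk MP.
case: (pickP (predC P)) => [i0 /= Pi0|allP]; last first.
  have {}allP i : P i by have /negbFE := allP i.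
  by exists M => //; apply/unitarymxP/matrixP => i j; rewrite MP // !mxE.
pose M0 := \matrix_(i, j) (if P i then M i j else 0).
have kerM0 : kermx (M0^t*) != 0.
  rewrite kermx_eq0 -row_leq_rank -ltnNge mxrank_map mxrank_tr ltn_neqAle rank_leq_row andbT.
  apply/negP => M0free; have /row_freeP[V /matrixP/(_ i0 i0)] : row_free M0 by [].
  rewrite !mxE eqxx big1 => [/esym/eqP|j _]; first by rewrite oner_eq0.
  by rewrite mxE (negPf Pi0) mul0r.
have [v vM0 v0] : exists2 v : 'rV[C]_N, v *m (M0^t*) = 0 & v != 0.
  have /rowV0Pn[i vi i_n0] := kerM0.
  by exists i => //; apply/eqP; rewrite -sub_kermx.
have vv0 : (v *m v^t*) 0 0 != 0 by rewrite -dotmxE dnorm_eq0.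
pose s := sqrtC ((v *m v^t*) 0 0).
pose u := s^-1 *: v.
have s0 : 0 <= s by rewrite sqrtC_ge0 -dotmxE dnorm_ge0.
have uu : (u *m u^t*) 0 0 = 1.
  rewrite /u linearZ /= map_mxZ -scalemxAl -scalemxAr scalerA mxE.
  by rewrite fmorphV /= (geC0_conj s0) -invfM -expr2 sqrtCK mulVf.
have uM j : P j -> \sum_t u 0 t * (M j t)^* = 0.
  move=> Pj; have /rowP/(_ j) := vM0; rewrite !mxE => E.
  transitivity (s^-1 * \sum_t v 0 t * (M0^t*) t j); last by rewrite E mulr0.
  rewrite mulr_sumr; apply: eq_bigr => t _.
  by rewrite !mxE Pj mulrA.
have Mu j : P j -> \sum_t M j t * (u 0 t)^* = 0.
  move=> Pj; rewrite -[LHS]conjCK rmorph_sum /= -[RHS](conjC0 C); congr (_^*).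
  by rewrite -[RHS](uM j Pj); apply: eq_bigr => t _; rewrite rmorphM /= conjCK mulrC.
clearbody u; pose M' := \matrix_(i, j) (if i == i0 then u 0 j else M i j).
pose P' := predU1 i0 P.
have [] := IHk [pred i | (i == i0) || P i] M'.
- apply: leq_trans ltk; apply: proper_card; apply/properP; split.
    by apply/subsetP => i; rewrite !inE negb_or => /andP[].
  by exists i0; rewrite !inE ?eqxx.
- move=> i j /=; rewrite !mxE.
  under eq_bigr => t _ do rewrite !mxE.
  have [-> _|ii0 /= Pi] := eqVneq i i0; have [-> _|ji0 /= Pj] := eqVneq j i0.
  + by rewrite /= ?eqxx -[RHS]uu mxE; apply: eq_bigr => t _; rewrite !mxE.
  + by rewrite uM // 1?eq_sym ?(negPf ji0).
  + by rewrite Mu // ?(negPf ii0).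
  rewrite -MP // mxE; by apply: eq_bigr => t _; rewrite !mxE.
move=> U Uu UE; exists U => // i j Pi; rewrite UE /= ?Pi ?orbT // mxE.
by case: eqVneq Pi => // ->; rewrite (negPf Pi0).
Qed.

(** * Additive characters of F_q and the error operators in coordinates *)

Section Character.
Variables (C : numClosedFieldType) (p m : nat) (F : finFieldType) (zeta : C).
Hypothesis p_pr : prime p.
Hypothesis m_gt0 : (0 < m)%N.
Hypothesis cardF : #|F| = (p ^ m)%N.
Hypothesis zeta_prim : p.-primitive_root zeta.

Definition chi (x : F) : C := zeta ^+ trFp p m x.

Let pcharF : p \in [pchar F] := card_finPcharP cardF p_pr.

Lemma natr_mod_eq (i j : nat) : (i%:R = j%:R :> F) -> i = j %[mod p].
Proof.
wlog ij : i j / (i <= j)%N => [th|].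
  by case/orP: (leq_total i j) => /th // h /esym/h.
move=> E; apply/eqP; rewrite eq_sym eqn_mod_dvd // (dvdn_pcharf pcharF).
by rewrite natrB // E subrr.
Qed.

(** Exponents of [zeta] matter only modulo p, so they can be compared in [F], where the trace is a
    sum of powers of Frobenius. *)
Lemma chiD x y : chi (x + y) = chi x * chi y.
Proof.
rewrite /chi -exprD; apply/eqP; rewrite (eq_prim_root_expr zeta_prim); apply/eqP.
apply: natr_mod_eq; rewrite natrD !trFpE // /frob_trace -big_split /=.
apply: eq_bigr => i _; rewrite exprDn_pchar //.
by rewrite (eq_pnat _ (pcharf_eq pcharF)) pnatX pnat_id.
Qed.

Lemma chi0 : chi 0 = 1.
Proof.
have chi0n : chi 0 != 0 by rewrite expf_neq0 // (prim_root_eq0 zeta_prim) -lt0n prime_gt0.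
by apply: (mulfI chi0n); rewrite -chiD addr0 mulr1.
Qed.

Lemma chi_norm x : `|chi x| = 1.
Proof.
suff z1 : `|zeta| = 1 by rewrite normrX z1 expr1n.
apply/eqP; rewrite -(@pexpr_eq1 C _ p) ?prime_gt0 //.
by rewrite -normrX (prim_expr_order zeta_prim) normr1.
Qed.

(** The trace polynomial is nonzero of degree p^(m-1) < q, so some x has nonzero trace. *)
Lemma chi_nontrivial b : b != 0 -> exists x, chi (x * b) != 1.
Proof.
move=> b0; pose f : {poly F} := \sum_(i < m) 'X^(p ^ i).
have f0 : f != 0.
  apply/eqP => /(congr1 (fun g : {poly F} => g`_1)).
  rewrite coef_sum coef0 (bigD1 (Ordinal m_gt0)) //= coefXn expn0 eqxx.
  rewrite big1 ?addr0 => [/eqP|i i0]; first by rewrite oner_eq0.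
  rewrite coefXn -(expn0 p) eqn_exp2l ?prime_gt1 //.
  by case: eqP => // E; case/eqP: i0; apply: val_inj.
have [x fx] : exists x, ~~ root f x.
  case: (pickP (fun x => ~~ root f x)) => [x|allr]; first by exists x.
  have := max_poly_roots f0 _ (enum_uniq F); rewrite -cardE => /(_ _)/=.
  rewrite ltnNge => H; have : false; last by [].
  have : all (root f) (enum F) by apply/allP => x _; apply/negbFE/allr.
  move=> /H /negP[].
  rewrite cardF; apply: leq_trans (size_sum _ _ _) _; apply/bigmax_leqP => i _.
  by rewrite size_polyXn ltn_exp2l ?prime_gt1.
exists (x / b); rewrite divfK // /chi -(expr0 zeta) (eq_prim_root_expr zeta_prim).
apply: contraNN fx => /eqP E; rewrite rootE horner_sum.
have := trFpE x p_pr cardF; rewrite /frob_trace.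
under [in X in _ -> X]eq_bigr => i _ do rewrite hornerXn.
move=> <-; rewrite mod0n in E; rewrite -(dvdn_pcharf pcharF).
by apply/eqP.
Qed.

Definition dot n (u v : 'rV[F]_n) : F := \sum_i u 0 i * v 0 i.

Lemma dotC n (u v : 'rV[F]_n) : dot u v = dot v u.
Proof. by apply: eq_bigr => i _; rewrite mulrC. Qed.

Lemma dotDl n (u v w : 'rV[F]_n) : dot (u + v) w = dot u w + dot v w.
Proof. by rewrite -big_split; apply: eq_bigr => i _; rewrite mxE mulrDl. Qed.

Lemma dot0l n (w : 'rV[F]_n) : dot 0 w = 0.
Proof. by rewrite /dot big1 // => i _; rewrite mxE mul0r. Qed.

Lemma chi_dot_nondeg n (b : 'rV[F]_n) : b != 0 -> exists u, chi (dot u b) != 1.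
Proof.
move=> b0; have [i bi] : exists i, b 0 i != 0.
  case: (pickP (fun i => b 0 i != 0)) => [i|no]; first by exists i.
  by case/eqP: b0; apply/rowP => i; rewrite mxE; have /negbFE/eqP := no i.
have [x xb] := chi_nontrivial bi; exists (x *: delta_mx 0 i).
suff -> : dot (x *: delta_mx 0 i) b = x * b 0 i by [].
rewrite /dot (bigD1 i) //= big1 => [|j ji]; last by rewrite !mxE (negPf ji) andbF mulr0 mul0r.
by rewrite !mxE !eqxx mulr1 addr0.
Qed.

Lemma chi_fourier n (g : 'rV[F]_n -> C) z :
  \sum_b chi (dot (- z) b) * \sum_w chi (dot w b) * g w = #|{: 'rV[F]_n}|%:R * g z.
Proof.
under eq_bigr => b _ do rewrite mulr_sumr.
rewrite exchange_big /= (bigD1 z) //= [X in _ + X]big1 => [|w wz].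
  under eq_bigr => b _ do rewrite mulrA -chiD -dotDl addNr dot0l chi0 mul1r.
  by rewrite sumr_const addr0 mulr_natl.
under eq_bigr => b _ do rewrite mulrA -chiD -dotDl dotC.
rewrite -mulr_suml (@bichar_sum _ _ (fun u v : 'rV[F]_n => chi (dot u v))).
- by rewrite addrC subr_eq0 (negPf wz) mulr0 mul0r.
- by move=> x y t; rewrite dotDl chiD.
- by move=> x y; rewrite dotC.
- exact: chi_dot_nondeg.
by move=> x y; rewrite chi_norm.
Qed.

Lemma act_left_opmx (S U : finType) (f : S -> S -> C) (psi : {ffun S * U -> C}) s t :
  act_left (opmx f) psi (s, t) = \sum_s' f s s' * psi (s', t).
Proof.
rewrite ffunE /=; apply: eq_bigr => s' _.
by rewrite !mxE !enum_rankK.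
Qed.

Lemma error_opE n (s : 'F_p) (a b : 'rV[F]_n) (U : finType)
    (psi : {ffun 'rV[F]_n * U -> C}) v w :
  act_left (error_op m zeta s a b) psi (v, w) =
    zeta ^+ s * (chi (dot (v - a) b) * psi (v - a, w)).
Proof.
have -> : error_op m zeta s a b = opmx (fun u t : 'rV[F]_n =>
    zeta ^+ s * \sum_r (u == r + a)%:R * (chi (dot t b) * (r == t)%:R)).
  rewrite /error_op /Xop /Zop opmx_mul; apply/matrixP => i j.
  by rewrite !mxE.
rewrite act_left_opmx (bigD1 (v - a)) //= [X in _ + X]big1 => [|t tv].
  rewrite addr0 (bigD1 (v - a)) //= [X in _ + X]big1 => [|r ra].
    by rewrite subrK !eqxx mul1r mulr1 addr0 mulrA.
  by rewrite (negPf ra) !mulr0.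
rewrite big1 ?mulr0 ?mul0r // => r _.
case: (r =P t) => [->|_]; last by rewrite !mulr0.
by rewrite -subr_eq eq_sym (negPf tv) mul0r.
Qed.

Lemma prod_eq_nat n (u v : 'rV[F]_n) : \prod_i (u 0 i == v 0 i)%:R = (u == v)%:R :> C.
Proof.
have [->|uv] := eqVneq u v; first by rewrite big1 // => i _; rewrite eqxx.
apply/eqP/prodf_eq0; case: (pickP (fun i => u 0 i != v 0 i)) => [i|no].
  by move=> /negPf ui; exists i; rewrite // ui.
by case/eqP: uv; apply/rowP => i; have /negbFE/eqP := no i.
Qed.

Lemma sum_pair (S U : finType) (f : S * U -> C) :
  \sum_st f st = \sum_s \sum_t f (s, t).
Proof. by rewrite pair_bigA /=; apply: eq_bigr => -[]. Qed.

(** * The encoding unitary of a family of orthonormal vectors *)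

Section FromVectors.
(** [psi x v w] is the coordinate at |v>|w> of the code vector with label x, where v belongs to the
    sender and w to the receiver. [detB] concerns errors at the receiver, [detA] those at the
    sender. *)
Variables (K r c d : nat) (psi : 'rV[F]_K -> 'rV[F]_(K + r + c) -> 'rV[F]_c -> C).
Hypothesis orth : forall x y,
  \sum_v \sum_w (psi x v w)^* * psi y v w = (x == y)%:R.
Hypothesis detB : forall a b : 'rV[F]_c, (a, b) != (0, 0) -> forall x y,
  \sum_v \sum_w (psi x v (w + a))^* * (chi (dot w b) * psi y v w) = 0.
Hypothesis detA : forall a b, (qweight a b < d)%N -> (a, b) != (0, 0) -> forall x y,
  \sum_v \sum_w (psi x (v + a) w)^* * (chi (dot v b) * psi y v w) = 0.

Let Q : C := #|{: 'rV[F]_c}|%:R.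
Let Q0 : Q != 0.
Proof. by rewrite pnatr_eq0 -lt0n; apply/card_gt0P; exists 0. Qed.

(* The receiver's state is maximally mixed, because the code detects every
   nontrivial error on the receiver's side. *)
Lemma marginal x y w w' :
  \sum_v (psi x v w)^* * psi y v w' = Q^-1 * ((x == y) && (w == w'))%:R.
Proof.
rewrite -[w](subrKC w'); set a := w - w'.
pose g z := \sum_v (psi x v (z + a))^* * psi y v z.
rewrite -[LHS]/(\sum_v (psi x v (w' + a))^* * psi y v w') -/(g w').
apply: (mulfI Q0); rewrite -chi_fourier mulVKf //.
(* The character sum of g at b is an inner product from [orth] if a = b = 0, and from [detB]
   otherwise. *)
have gE b : \sum_z chi (dot z b) * g z = ((x == y) && ((a, b) == (0, 0)))%:R.
  under eq_bigr => z _ do rewrite mulr_sumr.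
  rewrite exchange_big /=.
  have [[-> ->]|ab] := eqVneq (a, b) (0, 0).
    rewrite andbT -orth; apply: eq_bigr => v _; apply: eq_bigr => z _.
    by rewrite dotC dot0l chi0 addr0 mul1r.
  rewrite andbF -[RHS](detB ab x y); apply: eq_bigr => v _; apply: eq_bigr => z _.
  by rewrite mulrCA.
under eq_bigr => b _ do rewrite gE.
rewrite (bigD1 0) //= big1 => [|b b0].
  rewrite dotC dot0l chi0 mul1r addr0 xpair_eqE eqxx andbT.
  by rewrite -{2}[w']addr0 (inj_eq (addrI w')).
by rewrite xpair_eqE (negPf b0) !andbF mulr0.
Qed.

(** [good] selects the inputs whose ancillas are 0, and [uvec s] is the column that the unitary must
    have there; its factor sqrt(Q) cancels the q^(-c/2) of the c pairs. *)
Let good (s : 'rV[F]_(K + r + c)) := rsubmx (lsubmx s) == 0.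
Let uvec (s v : 'rV[F]_(K + r + c)) : C :=
  sqrtC Q * psi (lsubmx (lsubmx s)) v (rsubmx s).

(** By [marginal] the prescribed columns are orthonormal. [unitary_completion] fills in rows, hence
    the transpose. *)
Lemma isometry_extension :
  exists2 W : 'M[C]_#|{: 'rV[F]_(K + r + c)}|, W \is unitarymx &
    forall s v, good s -> W (enum_rank v) (enum_rank s) = uvec s v.
Proof.
pose M : 'M[C]_#|{: 'rV[F]_(K + r + c)}| := opmx uvec.
have [|U Uu UE] := @unitary_completion _ _ (fun i => good (enum_val i)) M.
  move=> i j /eqP gi /eqP gj; rewrite mxE.
  under eq_bigr => k _ do rewrite !mxE.
  rewrite (sum_enum_val (fun v => uvec (enum_val i) v * (uvec (enum_val j) v)^*)).
  under eq_bigr => v _ do rewrite /uvec rmorphM mulrACA -normCK mulrC [psi _ _ _ * _]mulrC.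
  rewrite -mulr_suml marginal ger0_norm ?sqrtC_ge0 ?ler0n // sqrtCK mulrAC mulVf // mul1r.
  congr (_ %:R); rewrite -(inj_eq enum_val_inj) eq_sym; congr nat_of_bool.
  apply/andP/eqP => [[/eqP ll /eqP rr]|->]; last by rewrite !eqxx.
  rewrite -[LHS]hsubmxK -[RHS]hsubmxK rr -[lsubmx (enum_val i)]hsubmxK.
  by rewrite -[lsubmx (enum_val j)]hsubmxK ll gi gj.
exists U^T; first by rewrite trmx_unitary.
by move=> s v gs; rewrite mxE UE ?enum_rankK // mxE !enum_rankK.
Qed.

Lemma EAQECC_of_vectors : EAQECC p m F zeta (K + r + c) K d c.
Proof.
have [W Wu WE] := isometry_extension.
exists r, W; split=> //.
have Q1 : sqrtC Q != 0 by rewrite sqrtC_eq0.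
(* For given w only the sender labels (x, 0, w) contribute, since the two halves of each pair must
   agree. *)
have codeE phi v w : act_left W (eaq_input r c phi) (v, w) = \sum_x phi x * psi x v w.
  rewrite ffunE /=.
  have ebitE (s : 'rV[F]_(K + r + c)) :
      \prod_(j < c) ebit C F (rsubmx s 0 j, w 0 j) = (sqrtC Q)^-1 * (rsubmx s == w)%:R.
    under eq_bigr => j _ do rewrite ffunE /=.
    rewrite big_split /= prod_eq_nat prodr_const card_ord exprVn; congr (_^-1 * _).
    by rewrite /Q card_mx mul1n natrX rootCX // ler0n.
  have zeroE (s : 'rV[F]_(K + r + c)) :
      \prod_(i < r) (rsubmx (lsubmx s) 0 i == 0)%:R = (good s)%:R :> C.
    rewrite /good -prod_eq_nat; apply: eq_bigr => i _.
    by rewrite [(0 : 'rV[F]_r) 0 i]mxE.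
  pose h (x : 'rV[F]_K) : 'rV[F]_(K + r + c) := row_mx (row_mx x 0) w.
  rewrite (bigID (fun s => good s && (rsubmx s == w))) /= [X in _ + X]big1 => [|s].
    rewrite addr0 (reindex_onto h (fun s => lsubmx (lsubmx s))) => [|s /andP[/eqP gs /eqP ws]].
      rewrite (eq_bigl predT) => [|x]; last first.
        by rewrite /good /h /= !row_mxKl !row_mxKr !eqxx.
      apply: eq_bigr => x _; rewrite ffunE /= ebitE zeroE.
      have gh : good (h x) by rewrite /good /h row_mxKl row_mxKr.
      rewrite WE // gh /uvec /h !row_mxKl !row_mxKr eqxx !mulr1.
      by field.
    by rewrite /h -gs -ws !hsubmxK.
  rewrite negb_and ffunE /= ebitE zeroE => /orP[/negPf->|/negPf->].
    by rewrite mulr0 mul0r mulr0.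
  by rewrite !mulr0.
move=> _ _ [f1 ->] [f2 ->] f12 s a b wab.
rewrite /inner in f12 *; rewrite sum_pair.
rewrite (reindex_inj (addIr a)) /=.
(* The trivial error is a scalar, and there the orthogonality [f12] is used; any other error is
   killed term by term through [detA]. *)
have [ab|ab] := eqVneq (a, b) (0, 0).
  case: ab => -> ->; rewrite -[RHS](mulr0 (zeta ^+ s)) -[in RHS]f12 sum_pair mulr_sumr.
  apply: eq_bigr => v _; rewrite mulr_sumr; apply: eq_bigr => w _.
  by rewrite error_opE dotC dot0l chi0 mul1r subr0 addr0 mulrCA.
transitivity (\sum_x \sum_y zeta ^+ s * (f1 x)^* * f2 y *
   \sum_v \sum_w (psi x (v + a) w)^* * (chi (dot v b) * psi y v w)); last first.
  by rewrite big1 // => x _; rewrite big1 // => y _; rewrite detA // mulr0.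
under [RHS]eq_bigr => x _ do under eq_bigr => y _ do rewrite mulr_sumr.
under [RHS]eq_bigr => x _ do rewrite exchange_big /=.
rewrite [RHS]exchange_big /=; apply: eq_bigr => v _.
under [RHS]eq_bigr => x _ do under eq_bigr => y _ do rewrite mulr_sumr.
under [RHS]eq_bigr => x _ do rewrite exchange_big /=.
rewrite [RHS]exchange_big /=; apply: eq_bigr => w _.
rewrite error_opE !codeE addrK rmorph_sum mulr_suml.
apply: eq_bigr => x _; rewrite !mulr_sumr.
by apply: eq_bigr => y _; rewrite rmorphM /=; ring.
Qed.

End FromVectors.
End Character.

(** * Entanglement-assisted codes from Hermitian codes *)

(** Makes a sender label together with a receiver label an element of one finite group, to which the
    Weyl operators apply. *)
HB.instance Definition _ (V W : finZmodType) := GRing.Zmodule.on (V * W)%type.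

Section CodeToEAQECC.
Variables (F L : finFieldType) (iota : {rmorphism F -> L}).
Variable bar : {rmorphism L -> L}.
Hypothesis barE : forall x, bar x = x ^+ #|F|.
Hypothesis cardL : #|L| = (#|F| ^ 2)%N.
Variables (C : numClosedFieldType) (p m : nat) (zeta : C).
Hypothesis p_pr : prime p.
Hypothesis m_gt0 : (0 < m)%N.
Hypothesis cardF : #|F| = (p ^ m)%N.
Hypothesis zeta_prim : p.-primitive_root zeta.
Local Notation "A ^h" := (dagger bar A) (at level 8, format "A ^h").
Local Notation chi := (@chi C p m F zeta).

(** When [bar] moves g, 1 and g form a basis of [L] over [F]; the error X(a) Z(b) is then encoded as
    one vector over [L], whose Hamming weight is the quantum weight. *)
Definition vec (g : L) n (a b : 'rV[F]_n) : 'rV[L]_n :=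
  map_mx iota a + g *: map_mx iota b.

Lemma vec_entry_eq0 g n (a b : 'rV[F]_n) i : bar g != g ->
  (vec g a b 0 i == 0) = ((a 0 i, b 0 i) == (0, 0)).
Proof.
move=> gg; rewrite !mxE; apply/eqP/eqP => [E|[-> ->]].
  by have [-> ->] := iota_coords_inj barE gg E.
by rewrite !rmorph0 mulr0 addr0.
Qed.

Lemma vec_eq0 g n (a b : 'rV[F]_n) : bar g != g ->
  (vec g a b == 0) = ((a, b) == (0, 0)).
Proof.
move=> gg; apply/eqP/eqP => [E|[-> ->]]; last by rewrite /vec !map_mx0 scaler0 addr0.
have Ei i : a 0 i = 0 /\ b 0 i = 0.
  have /eqP := congr1 (fun x : 'rV_n => x 0 i) E.
  by rewrite [X in _ == X]mxE vec_entry_eq0 // => /eqP[].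
by congr (_, _); apply/rowP => i; rewrite !mxE; have [] := Ei i.
Qed.

Lemma weight_vec g n (a b : 'rV[F]_n) : bar g != g ->
  weight (vec g a b) = qweight a b.
Proof. by move=> gg; apply: eq_card => i; rewrite !inE vec_entry_eq0. Qed.

(** The symplectic form is, up to a factor, the skew part of the Hermitian form, so Hermitian
    orthogonality makes Weyl operators commute. *)
Lemma symplectic_hermitian g n (a b a' b' : 'rV[F]_n) :
    let h := (vec g a b *m (vec g a' b')^h) 0 0 in
  (g - bar g) * iota (dot b a' - dot a b') = h - bar h.
Proof.
rewrite /= !mxE rmorph_sum -sumrB /dot -sumrB rmorph_sum mulr_sumr.
apply: eq_bigr => i _; rewrite !mxE !(rmorphD, rmorphB, rmorphM) /=.
rewrite !(bar_iota iota barE) (barK barE cardL); ring.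
Qed.

(** The rows of (H | M) span a stabilizer with q^(2h) elements on n + c qudits, which leaves a code
    of dimension q^(n + c - 2h) = q^K. *)
Lemma EAQECC_of_code h n c K d (H : 'M[L]_(h, n)) :
    row_free H -> \rank (H *m H^h) = c ->
    (forall x : 'rV[L]_n, x *m H^h = 0 -> x != 0 -> (d <= weight x)%N) ->
    (n + c = K + h.*2)%N ->
  EAQECC p m F zeta n K d c.
Proof.
move=> Hfree rH dualH nK.
have [ch] : (c <= h)%N by rewrite -rH rank_leq_row.
have [r nE] : exists r, n = (K + r + c)%N by exists (h - c).*2; lia.
subst n.
have [g gg] := bar_moves iota barE cardL.
have [re [im [xE reD imD]]] := iota_coords iota barE cardL gg.
have [M ME] : exists M : 'M[L]_(h, c), - (H *m H^h) = M *m M^h.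
  apply: (hermitian_factor iota barE cardL); last by rewrite mxrank_opp rH.
  by rewrite -sub0r daggerB dagger0 dagger_mul (daggerK barE cardL).
(* Since M^h has trivial left kernel, every nontrivial error at the receiver is detected. *)
have Mfree : row_free M^h.
  rewrite -row_leq_rank rank_dagger; apply: leq_trans (mxrankM_maxl M M^h).
  by rewrite -ME mxrank_opp rH.
have vecE n (x : 'rV[L]_n) : x = vec g (map_mx re x) (map_mx im x).
  by apply/rowP => i; rewrite !mxE -xE.
have map_reD n : {morph (fun x : 'rV[L]_n => map_mx re x) : x y / x + y}.
  by move=> x y; apply/rowP => i; rewrite !mxE reD.
have map_imD n : {morph (fun x : 'rV[L]_n => map_mx im x) : x y / x + y}.
  by move=> x y; apply/rowP => i; rewrite !mxE imD.
pose T : finZmodType := ('rV[F]_(K + r + c) * 'rV[F]_c)%type.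
pose e (u b : T) : C := chi (dot u.1 b.1) * chi (dot u.2 b.2).
have cD := chiD p_pr cardF zeta_prim; have c0 := chi0 p_pr cardF zeta_prim.
have cN (x : F) : `|chi x| = 1 by apply: (chi_norm _ p_pr zeta_prim).
have eE u b : e u b = chi (dot u.1 b.1 + dot u.2 b.2) by rewrite cD.
pose A (y : 'rV[L]_h) : T := (map_mx re (y *m H), map_mx re (y *m M)).
pose B (y : 'rV[L]_h) : T := (map_mx im (y *m H), map_mx im (y *m M)).
have gg' : g - bar g != 0 by rewrite subr_eq0 eq_sym.
(* The symplectic product with the element (y H, y M) of the stabilizer is
   governed by the Hermitian product with the rows of (H | M). *)
have sympE (a b : T) y :
    let s := ((vec g a.1 b.1 *m H^h + vec g a.2 b.2 *m M^h) *m y^h) 0 0 in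
    (g - bar g) * iota ((dot (A y).1 b.1 + dot (A y).2 b.2) -
                        (dot a.1 (B y).1 + dot a.2 (B y).2)) = s - bar s.
  have h1 := symplectic_hermitian g a.1 b.1 (A y).1 (B y).1.
  have h2 := symplectic_hermitian g a.2 b.2 (A y).2 (B y).2.
  rewrite /= -!vecE in h1 h2.
  rewrite /= opprD addrACA rmorphD mulrDr [dot _ b.1]dotC [dot _ b.2]dotC h1 h2.
  rewrite mulmxDl -!mulmxA -!dagger_mul [in RHS]mxE [in RHS]rmorphD.
  by rewrite [in RHS]opprD [in RHS]addrACA.
have isotropic y z : e (A y) (B z) = e (A z) (B y).
  rewrite !eE; congr chi; apply/esym/eqP; rewrite -subr_eq0 -(fmorph_eq0 iota).
  have /eqP := sympE (A y) (B y) z; rewrite /= -!vecE -!mulmxA.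
  have -> : y *m (H *m H^h) + y *m (M *m M^h) = 0 by rewrite -ME mulmxN subrr.
  by rewrite mul0mx mxE rmorph0 subrr mulf_eq0 (negPf gg').
have [psi [orth det]] : exists psi : 'I_#|{: 'rV[F]_K}| -> T -> C,
    (forall i j, \sum_u (psi i u)^* * psi j u = (i == j)%:R) /\
    (forall a b, (exists y, e (A y) b != e a (B y)) ->
      forall i j, \sum_u (psi i (u + a))^* * (e u b * psi j u) = 0).
  apply: (@stabilizer_code _ _ e _ _ _ _ 'rV[L]_h A B).
  - by move=> x y z; rewrite /e !dotDl !cD mulrACA.
  - by move=> x y; rewrite /e dotC [dot x.2 _]dotC.
  - move=> [x1 x2]; rewrite xpair_eqE negb_and.
    case/orP => /(chi_dot_nondeg p_pr m_gt0 cardF zeta_prim)[u uP].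
      by exists (u, 0); rewrite /e /= dot0l c0 mulr1.
    by exists (0, u); rewrite /e /= dot0l c0 mul1r.
  - by move=> x y; rewrite /e normrM !cN mulr1.
  - by move=> y z; rewrite /A !mulmxDl !map_reD.
  - by move=> y z; rewrite /B !mulmxDl !map_imD.
  - exact: isotropic.
  - move=> y [Ay _] [By _]; apply: (row_free_inj Hfree); rewrite mul0mx.
    by rewrite [LHS]vecE Ay By /vec !map_mx0 scaler0 addr0.
  rewrite card_prod !card_mx cardL -expnM -!expnD; congr (_ ^ _)%N; lia.
have detect (a b : T) :
    vec g a.1 b.1 *m H^h + vec g a.2 b.2 *m M^h != 0 ->
    exists y, e (A y) b != e a (B y).
  set t := _ + _ => t0; have [j tj] : exists j, t 0 j != 0.
    case: (pickP (fun j => t 0 j != 0)) => [j|no]; first by exists j.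
    by case/eqP: t0; apply/rowP => j; rewrite [RHS]mxE; have /negbFE/eqP := no j.
  have [u] := chi_nontrivial p_pr m_gt0 cardF zeta_prim (oner_neq0 F); rewrite mulr1 => u1.
  (* Scaled so that the Hermitian product of t with y is g u. Its skew part is (g - bar g) u, so the
     two phases differ by the factor [chi u], which is not 1. *)
  pose y : 'rV[L]_h := bar (g * iota u / t 0 j) *: delta_mx 0 j.
  exists y; apply: contraNneq u1.
  have := sympE a b y; rewrite /= -/t.
  have -> : (t *m y^h) 0 0 = g * iota u.
    rewrite /y /dagger linearZ /= map_mxZ trmx_delta map_delta_mx (barK barE cardL).
    by rewrite -scalemxAr -colE mxE [col _ _ _ _]mxE divfK.
  rewrite rmorphM (bar_iota iota barE) -mulrBl => /(mulfI gg')/fmorph_inj/eqP.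
  rewrite subr_eq => /eqP; rewrite !eE => ->; rewrite [chi (u + _)]cD.
  move: (chi (_ + _)) (cN (dot a.1 (B y).1 + dot a.2 (B y).2)) => w w1 E.
  have w0 : w != 0 by rewrite -normr_eq0 w1 oner_eq0.
  by apply/eqP/(mulIf w0); rewrite mul1r.
pose phi (x : 'rV[F]_K) v w := psi (enum_rank x) (v, w).
apply: (@EAQECC_of_vectors _ _ _ _ _ p_pr m_gt0 cardF zeta_prim _ _ _ _ phi).
- by move=> x y; rewrite -(inj_eq enum_rank_inj) -orth sum_pair.
- move=> a b ab x y; have /det/(_ (enum_rank x) (enum_rank y)) :
      exists z, e (A z) (0, b) != e (0, a) (B z).
    apply: detect => /=; rewrite {1}/vec !map_mx0 scaler0 addr0 mul0mx add0r.
    by rewrite mulmx_free_eq0 // vec_eq0.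
  rewrite sum_pair => E; rewrite -[RHS]E; apply: eq_bigr => v _; apply: eq_bigr => w _.
  rewrite /e /= [dot v 0]dotC dot0l c0 mul1r; congr ((psi _ (_, _))^* * _).
  by rewrite addr0.
move=> a b abd ab x y; have /det/(_ (enum_rank x) (enum_rank y)) :
    exists z, e (A z) (b, 0) != e (a, 0) (B z).
  apply: detect => /=; rewrite {2}/vec !map_mx0 scaler0 addr0 mul0mx addr0.
  (* Were it undetected, the error would be a nonzero vector of the Hermitian dual of [H], of weight
     at least d. *)
  apply: contraL abd => /eqP /dualH; rewrite vec_eq0 // ab weight_vec // -leqNgt.
  by apply.
rewrite sum_pair => E; rewrite -[RHS]E; apply: eq_bigr => v _; apply: eq_bigr => w _.
rewrite /e /= [dot w 0]dotC dot0l c0 mulr1; congr ((psi _ (_, _))^* * _).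
by rewrite addr0.
Qed.

(** The second code comes from [G], the first from a basis [H] of the Hermitian dual, whose own dual
    is the row space of [G]. *)
Lemma EAQECC_of_points n k l (a : 'I_n -> L) (w : 'I_n -> F) :
    good_points iota a w -> (0 < k)%N -> (k * (#|F| + 1) <= n)%N -> (l < k)%N ->
    (#|F| = 2 -> k = 1)%N ->
  EAQECC p m F zeta n (k - l) (n - k) (n - k - l) /\
  EAQECC p m F zeta n (n - k - l) k (k - l).
Proof.
move=> aw k0 kn lk q2.
have [G [distG dualG rG]] := grs_code barE cardL aw k0 kn lk q2.
have q1 : (1 < #|F|)%N := finNzRing_gt1 F.
have k3n : (k * 3 <= n)%N by apply: leq_trans kn; rewrite leq_mul2l; lia.
have Gfree : row_free G.
  apply: inj_row_free => y yG; apply/eqP; apply: contraT => /distG.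
  rewrite yG /weight; have -> : [set i | (0 : 'rV[L]_n) 0 i != 0] = set0.
    by apply/setP => i; rewrite !inE mxE eqxx.
  by rewrite cards0; lia.
have rankG : \rank G = k by apply/eqP.
split; last by apply: (EAQECC_of_code Gfree rG dualG); lia.
have rankK : \rank (kermx G^h) = (n - k)%N by rewrite mxrank_ker rank_dagger rankG.
have [H Hfree Hker] : exists2 H : 'M[L]_(n - k, n), row_free H & (H :=: kermx G^h)%MS.
  rewrite -rankK; exists (row_base (kermx G^h)); first exact: row_base_free.
  exact: eq_row_base.
have rankH : \rank H = (n - k)%N by apply/eqP.
have HG : H *m G^h = 0 by apply/sub_kermxP; rewrite Hker.
have GH : G *m H^h = 0.
  by have := dagger_mul bar H G^h; rewrite HG dagger0 (daggerK barE cardL).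
have Gker : (G :=: kermx H^h)%MS.
  have sub : (G <= kermx H^h)%MS by apply/sub_kermxP.
  apply/eqmxP; rewrite -(geq_leqif (mxrank_leqif_eq sub)).
  by rewrite mxrank_ker rank_dagger rankH rankG; lia.
refine (EAQECC_of_code (H := H) _ _ _ _).
- exact: Hfree.
(* The rank of the Gram matrix plus the dimension of the hull is the dimension of the code. [G] and
   [H] have the same hull, the intersection of their row spaces, of dimension l. *)
- have := mxrank_mul_ker H H^h; have := mxrank_mul_ker G G^h.
  rewrite rG rankG -(cap_eqmx (eqmx_refl G) Hker) capmxC (cap_eqmx (eqmx_refl H) Gker).
  have lin (u v : nat) : (k - l + u)%N = k -> (v + u)%N = (n - k)%N ->
    v = (n - k - l)%N by lia.
  by rewrite rankH; apply: lin.
- move=> x xH x0; have : (x <= kermx H^h)%MS by apply/sub_kermxP.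
  rewrite -Gker => /submxP[y yE]; rewrite yE; apply: distG.
  by apply: contraNneq x0 => y0; rewrite yE y0 mul0mx.
by lia.
Qed.

End CodeToEAQECC.

(* Choice of the points in the three cases *)
Local Close Scope sesquilinear_scope.
Local Close Scope ring_scope.

Theorem theorem8 (R : realType) (p m : nat) (F : finFieldType) (zeta : R[i])
    (n k : nat) :
  let q := p ^ m in
  prime p -> 0 < m -> #|F| = q ->
  (p.-primitive_root zeta)%R ->
  0 < n -> 1 <= k <= n %/ (q + 1) ->
  [\/ n - 1 %| q ^ 2 - 1,
      exists t : nat, n = t * q /\ 1 <= t <= q - 1
    | exists N t : nat, let n2 := N %/ gcdn N (q + 1) in
        [/\ 1 <= N, N %| q ^ 2 - 1, n = (t + 1) * N + 1
          & 1 <= t <= (q - 1) %/ n2 - 2]] ->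
  forall l : nat, 0 <= l <= k - 1 ->
    EAQECC_ge p m F zeta n (k - l) (n - k) (n - k - l)
    /\ EAQECC_ge p m F zeta n (n - k - l) k (k - l).
Proof.
move=> q p_pr m_gt0 cardF zeta_prim n0 /andP[k0 kn] cases l lk.
have q1 : 1 < q by rewrite -cardF finNzRing_gt1.
have {}kn : k * (q + 1) <= n by rewrite -leq_divRL // addn1.
have {}lk : l < k by move: lk; lia.
have [L [iota [bar barE cardL]]] := quadratic_extension F.
have [a [w aw]] : exists (a : 'I_n -> L) (w : 'I_n -> F), good_points iota a w.
  case: cases => [ndvd|[t [nE tq]]|[N [t [N0 Ndvd nE tM]]]].
  (* Condition 1 is the coset construction with N = n - 1 and a single coset; n - 1 > 0 because n >=
     q + 1. *)
  - have N0 : 0 < n - 1 by nia.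
    have nE : n = 1 * (n - 1) + 1 by lia.
    rewrite nE; apply: (good_points_cosets iota cardL); rewrite ?cardF -/q //=.
    rewrite divn_gt0; first by apply: dvdn_leq; [lia | exact: dvdn_cofactor_gcd].
    by rewrite divn_gt0 ?gcdn_gt0 ?N0 // dvdn_leq // dvdn_gcdl.
  - by rewrite nE -cardF; apply: (good_points_trace iota cardL); rewrite // cardF; lia.
  rewrite nE; apply: (good_points_cosets iota cardL); rewrite ?cardF -/q //.
  by move: tM; lia.
(* For q = 2, condition 1 gives n <= 4, and 3k <= n forces k = 1. Condition 2 gives n = 2 < 3k, and
   in condition 3 the bound on t is 0, so neither occurs. *)
have q2 : #|F| = 2 -> k = 1.
  rewrite cardF -/q => qE; move: cases; rewrite qE /=.
  case=> [/dvdn_leq|[t [nE tq]]|[N [t [N0 /dvdn_leq Ndvd nE tM]]]].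
  - by move/(_ isT); rewrite qE in kn; nia.
  - by rewrite qE in kn; nia.
  by have := leq_div (2 - 1) (N %/ gcdn N (2 + 1)); move: tM; lia.
have kn' : k * (#|F| + 1) <= n by rewrite cardF.
have [H1 H2] := EAQECC_of_points barE cardL p_pr m_gt0 cardF zeta_prim aw k0 kn' lk q2.
split; [by exists (n - k) | by exists k].
Qed.
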